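(* Let $K$ be a finite field, let $\mathbf{F}$ be the free group on $r\ge1$ generators, and let $1\ne w=u^d\in\mathbf{F}$ with $d\ge1$ and $u\in\mathbf{F}$ a non-power. Then $$\lim_{N\to\infty}\mathbb{E}_w[\mathrm{fix}]=\#\left\{p\in K[x]\,\middle|\,p\mid x^d-1\text{ and }p\text{ is monic}\right\}.$$ In particular, the limit does not depend on $u$.
   Context: $\mathbf{F}$ has a fixed basis $b_1,\ldots,b_r$; for $g_1,\ldots,g_r$ in a group $G$, $w(g_1,\ldots,g_r)$ is the image of $w$ under the homomorphism $\mathbf{F}\to G$, $b_i\mapsto g_i$. A $w$-random element of $\mathrm{GL}_N(K)$ is $w(g_1,\ldots,g_r)$ with $g_1,\ldots,g_r$ independent uniformly random elements of $\mathrm{GL}_N(K)$. $\mathrm{fix}(g)$ is the number of $v\in K^N$ (row vectors) with $vg=v$, and $\mathbb{E}_w[\mathrm{fix}]$ is its expected value on a $w$-random element of $\mathrm{GL}_N(K)$. An element $u\ne1$ is a non-power if it is not of the form $v^k$ with $v\in\mathbf{F}$ and $k\ge2$. *)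

(* Defs.v *)
From HB Require Import structures.
From mathcomp Require Import all_boot all_order all_algebra all_fingroup.
From mathcomp Require Import finmap.
From mathcomp Require Import all_classical all_reals all_analysis.

Set Implicit Arguments.
Unset Strict Implicit.
Unset Printing Implicit Defensive.

Import Order.TTheory GRing.Theory Num.Theory.
Import numFieldNormedType.Exports.

Local Open Scope group_scope.

(* The letter (i, false) stands for the basis element b_i and (i, true) for
   b_i^-1. *)
Notation letter r := ('I_r * bool)%type.

Definition inv_letter r (x : letter r) : letter r := (x.1, ~~ x.2).

Definition reduced r (s : seq (letter r)) : bool :=
  sorted (fun x y => y != inv_letter x) s.

Record freegroup (r : nat) : Type := FreeGroup {
  fgword :> seq (letter r);
  fgword_reduced : reduced fgword
}.
HB.instance Definition _ r := [isSub for @fgword r].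
HB.instance Definition _ r := [Choice of freegroup r by <:].

(* Left multiplication of a reduced word by one letter. *)
Definition push r (x : letter r) (s : seq (letter r)) : seq (letter r) :=
  if s is y :: s' then (if y == inv_letter x then s' else x :: s) else [:: x].

(* The reduced form of s ++ t when t is reduced. *)
Definition act_word r (s t : seq (letter r)) : seq (letter r) :=
  foldr (@push r) t s.

Definition inv_word r (s : seq (letter r)) : seq (letter r) :=
  rev (map (@inv_letter r) s).

Section FreeGroupLaws.
Variable r : nat.
Implicit Types (x y : letter r) (s t : seq (letter r)).

Lemma inv_letterK : involutive (@inv_letter r).
Proof. by case=> i b; rewrite /inv_letter /= negbK. Qed.

Lemma reduced_tail x s : reduced (x :: s) -> reduced s.
Proof. exact: path_sorted. Qed.

Lemma push_reduced x s : reduced s -> reduced (push x s).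
Proof.
case: s => [|y s] //= rs; case: eqP => [_|/eqP ny]; first exact: reduced_tail rs.
by rewrite /reduced /= ny.
Qed.

Lemma push_cons x s : reduced (x :: s) -> push x s = x :: s.
Proof. by case: s => [|y s] //= /andP[/negPf->]. Qed.

Lemma pushK x s : reduced s -> push (inv_letter x) (push x s) = s.
Proof.
case: s => [|y s] /= rs; first by rewrite inv_letterK eqxx.
case: eqP => [yE|_]; last by rewrite /= inv_letterK eqxx.
by rewrite -yE push_cons.
Qed.

Lemma act_word_reduced s t : reduced t -> reduced (act_word s t).
Proof. by move=> rt; elim: s => //= x s IH; exact: push_reduced. Qed.

Lemma act_push x s t :
  reduced t -> act_word (push x s) t = push x (act_word s t).
Proof.
move=> rt; case: s => [|y s] //=; case: eqP => [->|] //=.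
by rewrite -{1}[x]inv_letterK pushK //; exact: act_word_reduced.
Qed.

Lemma act_wordA s1 s2 t : reduced t ->
  act_word (act_word s1 s2) t = act_word s1 (act_word s2 t).
Proof. by move=> rt; elim: s1 => //= x s IH; rewrite act_push // IH. Qed.

Lemma act_word0 s : reduced s -> act_word s [::] = s.
Proof.
elim: s => //= x s IH rs.
by rewrite IH ?push_cons //; exact: reduced_tail rs.
Qed.

Lemma act_rcons s x t : act_word (rcons s x) t = act_word s (push x t).
Proof. by rewrite /act_word foldr_rcons. Qed.

Lemma inv_wordK : involutive (@inv_word r).
Proof.
move=> s; rewrite /inv_word map_rev revK -map_comp -[RHS]map_id.
by apply: eq_map => x; exact: inv_letterK.
Qed.

Lemma inv_word_reduced s : reduced s -> reduced (inv_word s).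
Proof.
rewrite /reduced /inv_word rev_sorted sorted_map; apply: sub_sorted => x y /=.
by apply: contraNneq => ->; rewrite inv_letterK.
Qed.

Lemma act_inv_word s : reduced s -> act_word (inv_word s) s = [::].
Proof.
elim: s => //= x s IH rs; have rs' := reduced_tail rs.
by rewrite /inv_word /= rev_cons act_rcons /= inv_letterK eqxx IH.
Qed.

Definition fg_one : freegroup r := @FreeGroup r [::] isT.
Definition fg_inv (u : freegroup r) : freegroup r :=
  FreeGroup (inv_word_reduced (fgword_reduced u)).
Definition fg_mul (u v : freegroup r) : freegroup r :=
  FreeGroup (act_word_reduced u (fgword_reduced v)).

Lemma fg_mulA : associative fg_mul.
Proof.
move=> u v w; apply: val_inj => /=; rewrite act_wordA //.
exact: fgword_reduced.
Qed.

Lemma fg_mul1 : left_id fg_one fg_mul.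
Proof. by move=> u; apply: val_inj. Qed.

Lemma fg_mulr1 : right_id fg_one fg_mul.
Proof. by move=> u; apply: val_inj; exact: act_word0 (fgword_reduced u). Qed.

Lemma fg_mulV : left_inverse fg_one fg_inv fg_mul.
Proof. by move=> u; apply: val_inj; exact: act_inv_word (fgword_reduced u). Qed.

Lemma fg_mulrV : right_inverse fg_one fg_inv fg_mul.
Proof.
move=> u; apply: val_inj => /=; rewrite -{1}[fgword u]inv_wordK.
exact/act_inv_word/inv_word_reduced/fgword_reduced.
Qed.

End FreeGroupLaws.

HB.instance Definition _ r := isGroup.Build (freegroup r)
  (@fg_mulA r) (@fg_mul1 r) (@fg_mulr1 r) (@fg_mulV r) (@fg_mulrV r).

Definition fg_gen r (i : 'I_r) : freegroup r :=
  @FreeGroup r [:: (i, false)] isT.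

Definition letter_eval r (G : groupType) (g : 'I_r -> G) (x : letter r) : G :=
  if x.2 then (g x.1)^-1 else g x.1.

(* w(g_1, ..., g_r); the lemmas below show that this is the homomorphism
   sending fg_gen i to g i. *)
Definition fg_eval r (G : groupType) (g : 'I_r -> G) (w : freegroup r) : G :=
  \prod_(x <- fgword w) letter_eval g x.

Section Evaluation.
Variables (r : nat) (G : groupType) (g : 'I_r -> G).

Lemma fg_eval_gen i : fg_eval g (fg_gen i) = g i.
Proof. by rewrite /fg_eval big_seq1. Qed.

Lemma fg_eval1 : fg_eval g 1 = 1.
Proof. by rewrite /fg_eval big_nil. Qed.

Lemma letter_eval_inv x : letter_eval g (inv_letter x) = (letter_eval g x)^-1.
Proof. by case: x => i [] //=; rewrite /letter_eval /= invgK. Qed.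

Lemma prod_push x s : \prod_(y <- push x s) letter_eval g y =
  letter_eval g x * \prod_(y <- s) letter_eval g y.
Proof.
case: s => [|y s] /=; first by rewrite big_seq1 big_nil mulg1.
case: eqP => [->|_]; last by rewrite !big_cons.
by rewrite big_cons letter_eval_inv mulgA mulgV mul1g.
Qed.

Lemma fg_evalM : {morph fg_eval g : u v / u * v}.
Proof.
move=> u v; rewrite /fg_eval /=; elim: (fgword u) => [|x s IH] /=.
  by rewrite big_nil mul1g.
by rewrite prod_push IH big_cons mulgA.
Qed.

Lemma fg_eval_unique (f : freegroup r -> G) :
  {morph f : u v / u * v} -> (forall i, f (fg_gen i) = g i) ->
  forall w, f w = fg_eval g w.
Proof.
move=> fM fgen.
have f1 : f 1 = 1 by apply: (@mulgI _ (f 1)); rewrite -fM !mulg1.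
have fV u : f u^-1 = (f u)^-1.
  by apply: (@mulgI _ (f u)); rewrite -fM !mulgV f1.
have rx (x : letter r) : reduced [:: x] by [].
have fx x : f (FreeGroup (rx x)) = letter_eval g x.
  case: x => i []; rewrite /letter_eval /= -fgen ?invgK.
    by rewrite -fV; congr f; apply: val_inj.
  by congr f; apply: val_inj.
case=> s; elim: s => [|x s IH] rs.
  by rewrite [RHS]big_nil -f1; congr f; apply: val_inj.
have rs' := reduced_tail rs.
have -> : FreeGroup rs = FreeGroup (rx x) * FreeGroup rs'.
  by apply: val_inj; rewrite /= push_cons.
by rewrite fM fg_evalM IH fx /fg_eval [X in _ = X * _]big_seq1.
Qed.

End Evaluation.

Definition nonpower r (u : freegroup r) : Prop :=
  u <> 1 /\ forall (v : freegroup r) (k : nat), (2 <= k)%N -> u <> v ^+ k.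

Local Close Scope group_scope.
Local Open Scope ring_scope.
Local Open Scope classical_set_scope.

(* {'GL_N[K]} consists of matrices of size N.-1.+1, which is N for N >= 1. *)
Definition fixGL (K : finFieldType) (N : nat) (g : {'GL_N[K]}) : nat :=
  #|[set v : 'rV[K]_N.-1.+1 | v *m GLval g == v]%SET|.

(* Average over all r-tuples of elements of GL_N(K). *)
Definition Efix (R : realType) (K : finFieldType) (r : nat) (w : freegroup r)
    (N : nat) : R :=
  (\sum_(g : {ffun 'I_r -> {'GL_N[K]}}) (fixGL (fg_eval g w))%:R)
  / #|{ffun 'I_r -> {'GL_N[K]}}|%:R.

Definition monic_divisors (K : fieldType) (q : {poly K}) : set {poly K} :=
  [set p | p \is monic /\ p %| q].

(* Polynomials are not a finType, so a finite set of them is counted through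
   fset_set, which is only meaningful on finite sets. *)
Lemma finite_monic_divisors (K : finFieldType) (q : {poly K}) :
  q != 0 -> finite_set (monic_divisors q).
Proof.
move=> q0; apply: (@sub_finite_set _ _ (range (@rVpoly K (size q)))).
  move=> p /= [_ pq]; exists (poly_rV p) => //.
  by rewrite poly_rV_K // dvdp_leq.
exact: (finite_image _ (@finite_finset _ setT)).
Qed.

(* Main.v *)
Require Import Defs.
From mathcomp Require Import all_boot all_order all_algebra all_fingroup.
From mathcomp Require Import finmap.
From mathcomp Require Import all_classical all_reals all_analysis.
From mathcomp Require Import ring.
Import Order.TTheory GRing.Theory Num.Theory.
Import numFieldNormedType.Exports.
Local Open Scope classical_set_scope.
Local Open Scope ring_scope.
Set Implicit Arguments.
Unset Strict Implicit.
Unset Printing Implicit Defensive.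

(** Up to conjugation [u] is cyclically reduced, of length [l] say.  Put
    [L = d * l] and let [x] be the [L]-periodic sequence of letters of [u ^ d].

    A vector fixed by [w(g)] is the same thing as a closed trajectory
    [v 0, v 1, ...] of period [L], where [v i.+1] is the image of [v i] under
    the matrix of the letter [x i]; it is recorded as a matrix with [L] rows
    ([fixed_loops]).  The edges of the trajectory labelled by a generator [b]
    prescribe the matrix of [b] on a subspace of some dimension [k b].  Such a
    prescription extends to an invertible matrix exactly when its sources and
    its targets satisfy the same linear relations, and then a uniform element
    of GL_N(K) obeys it with probability [1 / I(k b, N)], where [I(m, N)] is
    the number of [m] x [N] matrices with independent rows ([GL_count]).  All
    of this depends only on the left kernel of the matrix of the trajectory,
    and there are [I(n, N)] matrices with a given left kernel and rank [n].
    So the expectation is a sum, over finitely many kernels that do not depend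
    on [N], of [I(n, N) / \prod_b I(k b, N)] ([Efix_sum_kernels]).  Since
    [I(m, N)] is asymptotic to [q ^ (m * N)], where [q] is the order of [K], a
    term tends to 1 if [n = \sum_b k b] and to 0 if [n < \sum_b k b].

    The rank [n] counts the steps [i] at which [v i] is outside the span of
    its predecessors, and [\sum_b k b] counts the steps whose outcome is not
    forced by the earlier ones.  As [x] is reduced, a step that starts at a
    new vector is never forced; hence [n <= \sum_b k b]
    ([rank_visited_le]).  In case of equality the steps of the two kinds
    coincide, and they are the first [t = n] ones, wherever on the loop one
    starts.  Then every window of [t] consecutive vectors is a basis of their
    span, and [v (s + t)] is a combination of [v s, ..., v (s + t.-1)] to
    which the next letter applies term by term.  Following the terms shows
    that the coefficients do not depend on [s] and that [t], as well as every
    index with a nonzero coefficient, is a period of [x]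
    ([balanced_recurrence]).  Since [u] is not a power, these periods are
    multiples of [l]: the trajectory satisfies a linear recurrence in the
    shift by [l], given by a monic polynomial [p], and [p] divides [X^d - 1]
    because the trajectory closes up after [d] such shifts.

    Conversely, [l] copies of [K[X] / (p)] carry a trajectory satisfying that
    recurrence, every trajectory satisfying it has the same relations, and
    these relations determine [p].  So the kernels that contribute to the
    limit correspond to the monic divisors of [X^d - 1] ([card_critical]). *)

(** * Words that stay reduced when read cyclically *)

Section Letters.
Variable r : nat.

Lemma letter_dir (y z : letter r) : y.1 = z.1 -> y = z \/ y = inv_letter z.
Proof.
case: y z => [i a] [j b] /= ->; rewrite /inv_letter /=.
by case: a b => [] []; auto.
Qed.

Lemma inv_letter_neq (y : letter r) : inv_letter y != y.
Proof. by case: y => i []; rewrite /inv_letter xpair_eqE /= andbF. Qed.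

End Letters.

Section Words.
Variable r : nat.
Implicit Types (u c : freegroup r) (s : seq (letter r)).

Lemma act_word_cat s1 s2 : reduced (s1 ++ s2) -> act_word s1 s2 = s1 ++ s2.
Proof.
elim: s1 => //= y s1 IH red; rewrite IH ?push_cons //.
exact: reduced_tail red.
Qed.

Definition cyclic_letter (x0 : letter r) s i := nth x0 s (i %% size s).
Definition cyclically_reduced s :=
  forall x0 i, cyclic_letter x0 s i.+1 != inv_letter (cyclic_letter x0 s i).

Lemma cyclic_letter_periodic x0 s i k :
  cyclic_letter x0 s (i + k * size s) = cyclic_letter x0 s i.
Proof. by rewrite /cyclic_letter addnC modnMDl. Qed.

(** As long as the last letter is inverse to the first one, both can be
    stripped by a conjugation. *)
Lemma conj_cyclically_reduced u : u <> 1%g ->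
  exists c u', u = (c * u' * c^-1)%g /\ (0 < size (fgword u'))%N /\ cyclically_reduced u'.
Proof.
have [n] := ubnP (size (fgword u)); elim: n u => // n IH u un u1.
have rs := fgword_reduced u.
case E : (fgword u) => [|y s].
  by case: u1; apply: val_inj; rewrite /= E.
have [/eqP lasty|lasty] := boolP (last y s == inv_letter y); last first.
  exists 1%g, u; rewrite mul1g invg1 mulg1 E; split=> //; split=> // x0 i.
  rewrite /cyclic_letter; have := rs; rewrite E => red.
  have si : (i %% size (y :: s) < size (y :: s))%N by rewrite ltn_mod.
  have -> : (i.+1 %% size (y :: s) = if i %% size (y :: s) == size s then 0
                                     else (i %% size (y :: s)).+1)%N.
    rewrite -addn1 -modnDml addn1; case: eqP => [->|/eqP ne]; first by rewrite /= modnn.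
    by rewrite modn_small //= ltnS ltn_neqAle ne -ltnS.
  move: (_ %% _)%N si => {}i si; have [->|ne] := eqVneq i (size s).
    rewrite [nth x0 (y :: s) (size s)](_ : _ = last y s); last by rewrite -(last_nth x0).
    by apply: contraNneq lasty => /= yE; rewrite {2}yE inv_letterK.
  rewrite /reduced /= in red; move/(pathP x0): red => /(_ i); apply.
  by rewrite ltn_neqAle ne -ltnS.
case/lastP: s lasty E => [/eqP|s z]; first by rewrite eq_sym (negPf (inv_letter_neq y)).
rewrite last_rcons => -> E {z}.
have red1 : reduced (rcons s (inv_letter y)) by have := rs; rewrite E => /reduced_tail.
have red2 : reduced s.
  by move: red1; rewrite /reduced; case: (s) => //= z s'; rewrite rcons_path => /andP[].
have ry : reduced [:: y] by [].
pose u2 := FreeGroup red2; pose c := FreeGroup ry.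
have uE : u = (c * u2 * c^-1)%g.
  rewrite -mulgA; apply: val_inj; rewrite /= E.
  by rewrite /inv_word /= act_word_cat ?cats1 // push_cons // -E.
have [||c' [u' [E2 P]]] := IH u2.
- by move: un; rewrite E /= size_rcons ltnS => /ltnW.
- by move=> u21; apply: u1; rewrite uE u21 mulg1 mulgV.
exists (c * c')%g, u'; split=> //.
by rewrite uE E2 invMg !mulgA.
Qed.

Lemma nonpower_conj c u : nonpower (c * u * c^-1)%g -> nonpower u.
Proof.
move=> [n1 nk]; split; first by move=> u1; apply: n1; rewrite u1 mulg1 mulgV.
move=> v k k2 uE; apply: (nk (c * v * c^-1)%g k k2).
rewrite uE; elim: (k) => [|j IH]; first by rewrite !expg0 mulg1 mulgV.
by rewrite !expgS -IH !mulgA mulgKV.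
Qed.

Section Primitive.
Variables (x0 : letter r) (u : freegroup r).
Hypothesis u_gt0 : (0 < size (fgword u))%N.
Hypothesis u_cyc : cyclically_reduced u.
Local Notation x := (cyclic_letter x0 u).
Local Notation l := (size (fgword u)).

Lemma reduced_mkseq_cyclic n : reduced (mkseq x n).
Proof.
case: n => // n; apply/(pathP x0) => i; rewrite size_map size_iota => il.
rewrite -[_ :: _]/(mkseq x n.+1) nth_mkseq; last by rewrite ltnS ltnW.
by rewrite (nth_map 0%N) ?size_iota // nth_iota // add1n.
Qed.

Lemma fgword_expg_period e k : (forall i, x (i + e)%N = x i) ->
  fgword (FreeGroup (reduced_mkseq_cyclic e) ^+ k)%g = mkseq x (e * k).
Proof.
move=> xe; have xek j i : x (i + e * j)%N = x i.
  by elim: j i => [|j IH] i; rewrite ?muln0 ?addn0 // mulnS addnA IH xe.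
have catE j : mkseq x e ++ mkseq x (e * j) = mkseq x (e * j.+1).
  rewrite /mkseq mulnS iotaD map_cat; congr (_ ++ _).
  have -> : iota (0 + e) (e * j) = map (addn e) (iota 0 (e * j)).
    by rewrite -iotaDl addn0.
  by rewrite -map_comp; apply: eq_map => i /=; rewrite addnC xe.
elim: k => [|k IH]; first by rewrite expg0 muln0.
by rewrite expgS /= IH act_word_cat ?catE //; exact: reduced_mkseq_cyclic.
Qed.

Lemma mkseq_cyclic_letter : mkseq x l = fgword u.
Proof.
apply: (@eq_from_nth _ x0); rewrite size_mkseq // => i il.
by rewrite nth_mkseq // /cyclic_letter modn_small.
Qed.

(** By Bezout [gcdn j l] is a period as well; if it were a proper divisor of
    [l], then [u] would be a power of its initial segment of that length. *)
Lemma nonpower_period j : nonpower u -> (forall i, x (i + j)%N = x i) -> (l %| j)%N.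
Proof.
move=> [_ npu] xj; have [->|j_gt0] := posnP j; first exact: dvdn0.
have xe i : x (i + gcdn j l)%N = x i.
  have [p q E _] := egcdnP l j_gt0.
  rewrite -(cyclic_letter_periodic x0 u _ q) -addnA [(gcdn _ _ + _)%N]addnC -E.
  by elim: (p) => [|p' IH]; rewrite ?addn0 // mulSn addnCA addnC xj.
have el := dvdn_gcdr j l; have := dvdn_gcdl j l.
set e := gcdn j l in xe el * => ej; have [f fE] := dvdnP el.
have [f2|] := leqP 2 f.
  case: (npu (FreeGroup (reduced_mkseq_cyclic e)) f f2).
  by apply: val_inj; rewrite /= fgword_expg_period // mulnC -fE mkseq_cyclic_letter.
rewrite ltnS; case: f fE => [E|[|//]]; first by move: u_gt0; rewrite E.
by rewrite mul1n => ->.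
Qed.

End Primitive.
End Words.

(** * Reindexing and counting lemmas *)

Lemma big_shift_periodic (T : Type) (idx : T) (op : Monoid.com_law idx) (L s : nat)
  (F : nat -> T) : (forall i, F (i + L)%N = F i) ->
  \big[op/idx]_(i < L) F (s + i)%N = \big[op/idx]_(i < L) F i.
Proof.
case: L => [|L] Fper; first by rewrite !big_ord0.
elim: s => [|s IH]; first by apply: eq_bigr => i _; rewrite add0n.
rewrite -IH big_ord_recr big_ord_recl /= Monoid.mulmC; congr (op _ _).
  by rewrite addSnnS Fper addn0.
by apply: eq_bigr => i _; rewrite addSnnS.
Qed.

Lemma big_ord_mul (V : nmodType) (d l : nat) (F : nat -> V) :
  \sum_(i < d * l) F i = \sum_(s < l) \sum_(a < d) F (s + a * l)%N.
Proof.
rewrite exchange_big; elim: d => [|d IH]; first by rewrite mul0n !big_ord0.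
rewrite mulSnr big_split_ord big_ord_recr /= IH; congr (_ + _).
by apply: eq_bigr => s _; rewrite addnC.
Qed.

Lemma down_closed_count (p : nat -> bool) m : (forall i, p i.+1 -> p i) ->
  forall i, (i < m)%N -> p i = (i < \sum_(i < m) p i)%N.
Proof.
move=> dc; elim: m => [|m IH] i //; rewrite ltnS big_ord_recr /= => im.
have [pm|npm] := boolP (p m); last first.
  rewrite addn0; move: im; rewrite leq_eqVlt => /predU1P[->|/IH //].
  rewrite (negbTE npm); apply/esym/negbTE; rewrite -leqNgt.
  by rewrite -[X in (_ <= X)%N]card_ord -sum1_card leq_sum // => j _; case: (p j).
have pj : forall j, (j <= m)%N -> p j.
  move=> j; elim: {1 2}m pm => [|k IHk] pk; first by rewrite leqn0 => /eqP->.
  by rewrite leq_eqVlt => /predU1P[->//|]; apply: IHk; exact: dc.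
rewrite pj // (eq_bigr (fun=> 1%N)) => [|j _]; last by rewrite pj // ltnW.
by rewrite sum1_card card_ord addn1 ltnS im.
Qed.

(** * Ranks and kernels *)

Lemma rank_add_row (K : fieldType) (m N : nat) (A : 'M[K]_(m, N)) (u : 'rV[K]_N) :
  \rank (A + <<u>>)%MS = (\rank A + ~~ (u <= A)%MS)%N.
Proof.
case: (boolP (u <= A)%MS) => /= uA.
  by rewrite addn0 (addsmx_idPl _) ?genmxE.
rewrite addn1; apply/eqP; rewrite eqn_leq; apply/andP; split.
  apply: leq_trans (mxrank_adds_leqif _ _) _.
  have: (\rank <<u>> <= 1)%N by rewrite mxrank_gen rank_leq_row.
  by rewrite -(leq_add2l (\rank A)) addn1.
rewrite ltn_neqAle mxrankS ?addsmxSl // andbT.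
apply: contra uA => /eqP E.
have := mxrank_leqif_sup (addsmxSl A <<u>>)%MS => -[_]; rewrite E eqxx => /esym.
by apply: submx_trans; rewrite (submx_trans _ (addsmxSr _ _)) ?genmxE.
Qed.

Lemma rank_sum_le (K : fieldType) (N m : nat) (P : pred 'I_m) (A : 'I_m -> 'M[K]_N) :
  (forall i, \rank (A i) <= 1)%N -> (\rank (\sum_(i < m | P i) A i)%MS <= \sum_(i < m) P i)%N.
Proof.
move=> A1; rewrite big_mkcond /=.
elim/big_ind2: _ => [|m1 n1 m2 n2 h1 h2|i _]; first by rewrite mxrank0.
  by apply: leq_trans (mxrank_adds_leqif _ _) (leq_add h1 h2).
by case: (P i) => //; rewrite mxrank0.
Qed.

Section SameKernel.
Variable K : fieldType.

(** The left kernel of a matrix consists of the linear relations among its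
    rows, so the two matrices may have different widths. *)
Definition same_ker m n1 n2 (A : 'M[K]_(m, n1)) (B : 'M[K]_(m, n2)) :=
  (kermx A == kermx B)%MS.

Lemma same_kerP m n1 n2 (A : 'M[K]_(m, n1)) (B : 'M[K]_(m, n2)) :
  reflect (forall p (C : 'M[K]_(p, m)), C *m A = 0 <-> C *m B = 0) (same_ker A B).
Proof.
apply: (iffP andP) => [[h1 h2] p C|H].
  by split=> /sub_kermxP h; apply/sub_kermxP; apply: submx_trans h _.
by split; apply/sub_kermxP/H; rewrite mulmx_ker.
Qed.

Lemma same_ker_rowP m n1 n2 (A : 'M[K]_(m, n1)) (B : 'M[K]_(m, n2)) :
  (forall c : 'rV_m, c *m A = 0 <-> c *m B = 0) -> same_ker A B.
Proof.
move=> H; apply/same_kerP => p C; split=> h; apply/row_matrixP => i;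
  by rewrite row_mul row0; apply/H; rewrite -row_mul h row0.
Qed.

Lemma same_ker_sym m n1 n2 (A : 'M[K]_(m, n1)) (B : 'M[K]_(m, n2)) :
  same_ker A B = same_ker B A.
Proof. by rewrite /same_ker andbC. Qed.

Lemma same_ker_trans m n1 n2 n3 (A : 'M[K]_(m, n1)) (B : 'M[K]_(m, n2)) (C : 'M[K]_(m, n3)) :
  same_ker A B -> same_ker B C -> same_ker A C.
Proof. by rewrite /same_ker => /eqmxP h /eqmxP h'; apply/eqmxP; apply: eqmx_trans h h'. Qed.

Lemma same_ker_rank m n1 n2 (A : 'M[K]_(m, n1)) (B : 'M[K]_(m, n2)) :
  same_ker A B -> \rank A = \rank B.
Proof.
move/eqmxP => E; have := eqmx_rank (introT eqmxP E); rewrite !mxrank_ker => e.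
by rewrite -(subKn (rank_leq_row A)) e subKn ?rank_leq_row.
Qed.

Lemma same_ker_mul m p n1 n2 (D : 'M[K]_(p, m)) (A : 'M[K]_(m, n1)) (B : 'M[K]_(m, n2)) :
  same_ker A B -> same_ker (D *m A) (D *m B).
Proof. by move/same_kerP => H; apply/same_kerP => q C; rewrite !mulmxA. Qed.

Lemma same_ker_free m n1 n2 (A : 'M[K]_(m, n1)) (C : 'M[K]_(n1, n2)) :
  row_free C -> same_ker (A *m C) A.
Proof.
move=> fC; apply/same_kerP => p D; rewrite mulmxA; split=> [E|->]; last by rewrite mul0mx.
by apply: (row_free_inj fC); rewrite mul0mx.
Qed.

(** The rows of [1%:M - A *m pinvmx A] are relations among the rows of [A],
    hence among those of [B]. *)
Lemma ker_factor m n1 n2 (A : 'M[K]_(m, n1)) (B : 'M[K]_(m, n2)) :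
  (kermx A <= kermx B)%MS -> B = A *m (pinvmx A *m B).
Proof.
move=> AB; have : (1%:M - A *m pinvmx A <= kermx B)%MS.
  apply: submx_trans AB; apply/sub_kermxP.
  by rewrite mulmxBl mul1mx mulmxKpV ?subrr.
by move/sub_kermxP/eqP; rewrite mulmxBl mul1mx subr_eq0 mulmxA => /eqP.
Qed.

(** The factor of [ker_factor] is injective on the row space of [S], and can be
    modified on a complement of that space so as to become invertible. *)
Lemma same_ker_unitP m n (S T : 'M[K]_(m, n)) :
  reflect (exists2 g, g \in unitmx & S *m g = T) (same_ker S T).
Proof.
apply: (iffP idP) => [ST|[g gu <-]]; last first.
  by rewrite same_ker_sym; apply: same_ker_free; rewrite row_free_unit.
have /andP[le _] := ST; have TE := ker_factor le.
have [|g gu E] := @complete_unitmx _ _ _ S (pinvmx S *m T).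
  by rewrite -TE (same_ker_rank ST).
by exists g; rewrite // -E -TE.
Qed.

Lemma kermx_cokermx m (T : 'M[K]_m) : (kermx (cokermx T) == T)%MS.
Proof.
apply/andP; split; first by rewrite submxE mulmx_ker.
by rewrite sub_kermx mulmx_coker.
Qed.

End SameKernel.

(** * The trajectory of a fixed vector *)

Section Trajectory.
Variables (K : fieldType) (N r L : nat).
Variables (v : nat -> 'rV[K]_N) (x : nat -> letter r) (h : letter r -> 'M[K]_N).
Hypothesis hK : forall y, h y *m h (inv_letter y) = 1%:M.
Hypothesis step : forall i, v i.+1 = v i *m h (x i).
Hypothesis red : forall i, x i.+1 != inv_letter (x i).
Hypothesis L_gt0 : (0 < L)%N.
Hypothesis vper : forall i, v (i + L)%N = v i.
Hypothesis xper : forall i, x (i + L)%N = x i.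

(** Edge [i] joins [v i] to [v i.+1] and is labelled [x i]; read backwards it
    is labelled by the inverse letter.  When the generators of [x i] and [y]
    agree, this is the index of the vertex to which [h y] applies. *)
Definition endpoint (y : letter r) (i : nat) : nat := (i + (x i != y))%N.
Definition visited m := (\sum_(i < m) <<v i>>)%MS.
(** The subspace on which the first [m] edges prescribe [h y]. *)
Definition domain y m := (\sum_(i < m | (x i).1 == y.1) <<v (endpoint y i)>>)%MS.
Definition new_vector m := ~~ (v m <= visited m)%MS.
Definition free_step m := ~~ (v m <= domain (x m) m)%MS.

Lemma endpoint_step y i : (x i).1 = y.1 ->
  v (endpoint y i) *m h y = v (endpoint (inv_letter y) i).
Proof.
rewrite /endpoint => /letter_dir[] E; rewrite E eqxx.
  by rewrite eq_sym inv_letter_neq addn0 addn1 step E.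
by rewrite inv_letter_neq addn0 addn1 step E -mulmxA -{2}[y]inv_letterK hK mulmx1.
Qed.

(** Only the edge [m.-1] could have [m] as an endpoint, and it would then have
    to be labelled by the inverse of [x m]. *)
Lemma endpoint_lt i m : (i < m)%N -> (x i).1 = (x m).1 -> (endpoint (x m) i < m)%N.
Proof.
rewrite /endpoint => im E; case: eqP => [_|/eqP ne]; rewrite ?addn0 // addn1.
rewrite ltn_neqAle im andbT; apply/eqP => E'.
have := red i; rewrite E'; have [E2|->] := letter_dir E.
  by rewrite E2 eqxx in ne.
by rewrite inv_letterK eqxx.
Qed.

Lemma visited_sup m i : (i < m)%N -> (v i <= visited m)%MS.
Proof. by move=> im; apply: (sumsmx_sup (Ordinal im)); rewrite ?genmxE. Qed.

Lemma domain_sup y m i : (i < m)%N -> (x i).1 = y.1 ->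
  (v (endpoint y i) <= domain y m)%MS.
Proof.
by move=> im E; apply: (sumsmx_sup (Ordinal im)); rewrite ?genmxE //= E.
Qed.

Lemma domain_sub m : (domain (x m) m <= visited m)%MS.
Proof.
apply/sumsmx_subP => i /eqP E; rewrite genmxE; apply: visited_sup.
exact: endpoint_lt.
Qed.

(** The part of the domain of [x m] known so far is spanned by vectors [v i]
    with [i < m]. *)
Lemma new_free_step m : new_vector m -> free_step m.
Proof. by apply: contra => /submx_trans; apply; exact: domain_sub. Qed.

Lemma domain_step y m : (domain y m *m h y <= domain (inv_letter y) m)%MS.
Proof.
rewrite (sumsmxMr _ _ (h y)); apply/sumsmx_subP => i /eqP E.
rewrite (eqmxMr _ (genmxE _)) endpoint_step //.
exact: domain_sup.
Qed.

(** A step whose outcome is prescribed ends in the span of the vectors visited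
    before. *)
Lemma newS_free_step m : new_vector m.+1 -> free_step m.
Proof.
apply: contra => H; rewrite step.
apply: submx_trans (submxMr _ H) _; apply: submx_trans (domain_step _ _) _.
apply/sumsmx_subP => i _; rewrite genmxE; apply: visited_sup.
by rewrite /endpoint; case: (_ != _); rewrite ?addn1 ?addn0 ltnS // ltnW.
Qed.

Lemma rank_visited m : \rank (visited m) = (\sum_(i < m) new_vector i)%N.
Proof.
elim: m => [|m IH]; first by rewrite /visited !big_ord0 mxrank0.
by rewrite /visited !big_ord_recr /= rank_add_row IH.
Qed.

Lemma domainS y m : domain y m.+1 =
  (domain y m + (if (x m).1 == y.1 then <<v (endpoint y m)>> else 0))%MS.
Proof. by rewrite /domain big_mkcond big_ord_recr -big_mkcond. Qed.

(** Edge [m] enlarges the domain of its label exactly when it enlarges the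
    domain of the inverse letter, because [h] maps one onto the other. *)
Lemma mem_domain_inv y m : (x m).1 = y.1 ->
  (v (endpoint y m) <= domain y m)%MS = (v m <= domain (x m) m)%MS.
Proof.
move=> /letter_dir[] E; first by rewrite /endpoint E eqxx addn0.
have -> : y = inv_letter (x m) by rewrite E inv_letterK.
rewrite /endpoint eq_sym inv_letter_neq addn1 step; apply/idP/idP => H.
  have := submxMr (h (inv_letter (x m))) H.
  rewrite -mulmxA hK mulmx1 => /submx_trans; apply.
  by have := domain_step (inv_letter (x m)) m; rewrite inv_letterK.
by apply: submx_trans (submxMr _ H) _; exact: domain_step.
Qed.

Lemma rank_domain m :
  (\sum_(b < r) \rank (domain (b, false) m))%N = (\sum_(i < m) free_step i)%N.
Proof.
elim: m => [|m IH].
  by rewrite big_ord0 big1 // => b _; rewrite /domain big_ord0 mxrank0.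
rewrite big_ord_recr /= -IH (bigD1 (x m).1) //= [in RHS](bigD1 (x m).1) //=.
rewrite domainS /= eqxx rank_add_row mem_domain_inv //.
rewrite [in RHS]addnAC; congr (_ + _)%N.
apply: eq_bigr => b bx; rewrite domainS /= eq_sym (negPf bx).
by rewrite addsmx0.
Qed.

Lemma not_new_late i : (L <= i)%N -> new_vector i = false.
Proof.
move=> Li; apply/negbTE; rewrite negbK -(subnK Li) vper visited_sup //.
by rewrite -addn1 leq_add2l.
Qed.

(** After one turn around the loop all edges have been used. *)
Lemma not_free_late i : (L <= i)%N -> free_step i = false.
Proof.
move=> Li; apply/negbTE; rewrite negbK -{1}(subnK Li) vper -[v _]/(v (i - L)%N).
have E : x (i - L)%N = x i by rewrite -[in RHS](subnK Li) xper.
have -> : (i - L)%N = endpoint (x i) (i - L) by rewrite /endpoint E eqxx addn0.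
by rewrite domain_sup ?E // ltn_subrL L_gt0 (leq_trans L_gt0).
Qed.

Lemma rank_visited_le : (\rank (visited L) <= \sum_(b < r) \rank (domain (b, false) L))%N.
Proof.
rewrite rank_visited rank_domain; apply: leq_sum => i _.
by move: (@new_free_step i); case: (new_vector i) => // ->.
Qed.

Section Balanced.
Hypothesis bal : \rank (visited L) = (\sum_(b < r) \rank (domain (b, false) L))%N.

Let t := \rank (visited L).

(** Every new vector is followed by a free step, and by [bal] there are equally
    many of both. *)
Lemma free_step_new i : free_step i = new_vector i.
Proof.
have [Li|iL] := leqP L i; first by rewrite not_new_late ?not_free_late.
have := bal; rewrite rank_visited rank_domain => /eqP.
have le (j : 'I_L) : true -> (new_vector j <= free_step j ?= iff (free_step j == new_vector j))%N.
  move=> _; split.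
    by move: (@new_free_step j); case: (new_vector j) => // ->.
  by rewrite eq_sym; case: (new_vector j); case: (free_step j).
rewrite (leqif_sum le) => /forallP /(_ (Ordinal iL)) /=.
by move/eqP.
Qed.

(** If [v i.+1] is new then step [i] is free, hence [v i] is new. *)
Lemma new_vectorE i : new_vector i = (i < t)%N.
Proof.
have dc j : new_vector j.+1 -> new_vector j by move=> /newS_free_step; rewrite free_step_new.
rewrite /t rank_visited.
have [iL|Li] := ltnP i L; first exact: down_closed_count.
rewrite not_new_late //; apply/esym/negbTE; rewrite -leqNgt (leq_trans _ Li) //.
by rewrite -[X in (_ <= X)%N]card_ord -sum1_card leq_sum // => j _; case: (new_vector j).
Qed.

Lemma rank_visited_t : \rank (visited t) = t.
Proof.
rewrite rank_visited (eq_bigr (fun=> 1%N)) => [|j _]; last by rewrite new_vectorE ltn_ord.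
by rewrite sum1_card card_ord.
Qed.

Lemma window_free : row_free (\matrix_(j < t) v j).
Proof.
rewrite -row_leq_rank -{1}rank_visited_t mxrankS //.
apply/sumsmx_subP => i _; rewrite genmxE.
by rewrite -[v i](rowK (fun j : 'I_t => v j)) row_sub.
Qed.

Lemma next_domain : (v t <= domain (x t) t)%MS.
Proof. by have := free_step_new t; rewrite new_vectorE ltnn => /negbT; rewrite negbK. Qed.

(** Step [t] is not free, so [v t] is in the domain of [x t], which is spanned
    by some of the basis vectors [v 0, ..., v t.-1]: those where an edge
    labelled [x t] starts or an edge labelled by its inverse ends. *)
Lemma next_support : exists2 a : 'rV[K]_t, v t = \sum_(j < t) a 0 j *: v j &
  forall j : 'I_t, a 0 j != 0 -> x j = x t \/
     (0 < j)%N /\ x j.-1 = inv_letter (x t).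
Proof.
pose B := \matrix_(j < t) v j.
(* The diagonal 0/1 matrix of the predicate good cuts a combination of the
   basis vectors down to the admissible ones. *)
pose good (j : 'I_t) := (x j == x t) || (0 < j)%N && (x j.-1 == inv_letter (x t)).
have : (domain (x t) t <= diag_mx (\row_j (good j)%:R) *m B)%MS.
  apply/sumsmx_subP => i /eqP E; rewrite genmxE.
  have lt := endpoint_lt (ltn_ord i) E.
  have <- : row (Ordinal lt) (diag_mx (\row_j (good j)%:R) *m B) = v (endpoint (x t) i).
    rewrite row_mul row_diag_mx -scalemxAl -rowE rowK mxE /good /=.
    have -> : (x (endpoint (x t) i) == x t) ||
        (0 < endpoint (x t) i)%N && (x (endpoint (x t) i).-1 == inv_letter (x t)).
      rewrite /endpoint; have [e|ne] := eqVneq (x i) (x t).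
        by rewrite addn0 e eqxx.
      have [E2|E2] := letter_dir E; first by rewrite E2 eqxx in ne.
      by rewrite addn1 /= E2 eqxx orbT.
    by rewrite scale1r.
  exact: row_sub.
move/(submx_trans next_domain) => /submxP[c E].
exists (c *m diag_mx (\row_j (good j)%:R)).
  rewrite E mulmxA mulmx_sum_row; apply: eq_bigr => j _.
  by rewrite rowK.
move=> j; rewrite mul_mx_diag !mxE; case: (boolP (good j)) => [|_]; last by rewrite mulr0 eqxx.
by case/orP => [/eqP|/andP[j0 /eqP]]; auto.
Qed.

End Balanced.

End Trajectory.

(** * Critical trajectories satisfy a linear recurrence *)

Section Recurrence.
Variables (K : fieldType) (N r L : nat).
Variables (v : nat -> 'rV[K]_N) (x : nat -> letter r) (h : letter r -> 'M[K]_N).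
Hypothesis hK : forall y, h y *m h (inv_letter y) = 1%:M.
Hypothesis step : forall i, v i.+1 = v i *m h (x i).
Hypothesis red : forall i, x i.+1 != inv_letter (x i).
Hypothesis L_gt0 : (0 < L)%N.
Hypothesis vper : forall i, v (i + L)%N = v i.
Hypothesis xper : forall i, x (i + L)%N = x i.
Hypothesis bal :
  \rank (visited v L) = (\sum_(b < r) \rank (domain v x (b, false) L))%N.

Let t := \rank (visited v L).

Let sv s i := v (s + i)%N.
Let sx s i := x (s + i)%N.

Lemma visited_shift s : visited (sv s) L = visited v L.
Proof.
by apply: (big_shift_periodic _ s (F := fun i => <<v i>>%MS)) => i; rewrite vper.
Qed.

Lemma domain_shift s y : domain (sv s) (sx s) y L = domain v x y L.
Proof.
rewrite /domain big_mkcond [in RHS]big_mkcond /= -[RHS](big_shift_periodic _ s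
  (F := fun i => if (x i).1 == y.1 then <<v (endpoint x y i)>>%MS else 0)).
  by apply: eq_bigr => i _; rewrite /sv /endpoint /sx addnA.
by move=> i; rewrite /endpoint xper addnAC vper.
Qed.

(** The two sides are attached to the loop, so any vertex may be taken as its
    origin. *)
Lemma bal_shift s : \rank (visited (sv s) L) =
  (\sum_(b < r) \rank (domain (sv s) (sx s) (b, false) L))%N.
Proof.
by rewrite visited_shift bal; apply: eq_bigr => b _; rewrite domain_shift.
Qed.

Lemma window_free_shift s : row_free (\matrix_(j < t) v (s + j)%N).
Proof.
rewrite /t -(visited_shift s).
apply: (@window_free K N r L (sv s) (sx s) h) => //.
- by move=> i; rewrite /sv addnS step.
- by move=> i; rewrite /sx addnS red.
- by move=> i; rewrite /sv addnA vper.
- by move=> i; rewrite /sx addnA xper.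
- exact: bal_shift.
Qed.

Lemma next_support_shift s :
  exists a : 'rV[K]_t, v (s + t)%N = \sum_(j < t) a 0 j *: v (s + j)%N /\
  forall j : 'I_t, a 0 j != 0 -> x (s + j)%N = x (s + t)%N \/
     (0 < j)%N /\ x (s + j.-1)%N = inv_letter (x (s + t)%N).
Proof.
rewrite /t -(visited_shift s).
have [] := @next_support K N r L (sv s) (sx s) h hK _ _ L_gt0 _ _ (bal_shift s).
- by move=> i; rewrite /sv addnS step.
- by move=> i; rewrite /sx addnS red.
- by move=> i; rewrite /sv addnA vper.
- by move=> i; rewrite /sx addnA xper.
by move=> a aE aS; exists a.
Qed.

Lemma window_inj s (a b : 'I_t -> K) :
  \sum_j a j *: v (s + j)%N = \sum_j b j *: v (s + j)%N -> a =1 b.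
Proof.
move=> E; have /row_free_inj inj := window_free_shift s.
suff /inj/rowP E2 : \row_j a j *m \matrix_(j < t) v (s + j)%N =
            \row_j b j *m \matrix_(j < t) v (s + j)%N.
  by move=> j; have := E2 j; rewrite !mxE.
rewrite !mulmx_sum_row; under eq_bigr do rewrite rowK mxE.
by under [in RHS]eq_bigr do rewrite rowK mxE.
Qed.

Lemma recurrence_coefs : exists a : nat -> 'rV[K]_t, 
  (forall s, v (s + t)%N = \sum_(j < t) a s 0 j *: v (s + j)%N) /\
  forall s (j : 'I_t), a s 0 j != 0 -> x (s + j)%N = x (s + t)%N \/
     (0 < j)%N /\ x (s + j.-1)%N = inv_letter (x (s + t)%N).
Proof.
have [a aP] := choice next_support_shift.
by exists a; split=> s; have [] := aP s.
Qed.

End Recurrence.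

Section Coefs.
Variables (K : fieldType) (N r t : nat).
Variables (v : nat -> 'rV[K]_N) (x : nat -> letter r) (h : letter r -> 'M[K]_N).
Hypothesis hK : forall y, h y *m h (inv_letter y) = 1%:M.
Hypothesis step : forall i, v i.+1 = v i *m h (x i).
Hypothesis red : forall i, x i.+1 != inv_letter (x i).
Hypothesis v_inj : forall s (b c : nat -> K),
  \sum_(j < t) b j *: v (s + j)%N = \sum_(j < t) c j *: v (s + j)%N ->
  forall j, (j < t)%N -> b j = c j.
Variable a : nat -> nat -> K.
Hypothesis aE : forall s, v (s + t)%N = \sum_(j < t) a s j *: v (s + j)%N.
Hypothesis aS : forall s j, (j < t)%N -> a s j != 0 ->
  x (s + j)%N = x (s + t)%N \/
  (0 < j)%N /\ x (s + j.-1)%N = inv_letter (x (s + t)%N).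

(** Otherwise [v (s + t)] would be a combination of the other vectors of the
    window that starts at [s.+1]. *)
Lemma coef0_neq0 s : (0 < t)%N -> a s 0 != 0.
Proof.
case: t v_inj aE => [//|t'] inj E _; apply/eqP => a0.
have H := inj s.+1 (fun j => (j == t')%:R)
  (fun j => if (j < t')%N then a s j.+1 else 0).
have {}/H H :
  \sum_(j < t'.+1) (j == t' :> nat)%:R *: v (s.+1 + j)%N =
  \sum_(j < t'.+1) (if (j < t')%N then a s j.+1 else 0) *: v (s.+1 + j)%N.
  rewrite !big_ord_recr /= eqxx ltnn scale0r addr0 scale1r.
  rewrite big1 => [|j _]; last by rewrite ltn_eqF // scale0r.
  rewrite add0r addSnnS E big_ord_recl a0 scale0r add0r.
  by apply: eq_bigr => j _; rewrite ltn_ord /= addSnnS.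
by have := H t' (ltnSn _); move=> /=; rewrite eqxx ltnn => /eqP; rewrite oner_eq0.
Qed.

(** No edge of the window ends at [v s], so the letter [x (s + t)] has to move
    [v s] along edge [s]. *)
Lemma letter_period s : (0 < t)%N -> x (s + t)%N = x s.
Proof.
move=> t_gt0; have [<-|[]//] := aS t_gt0 (coef0_neq0 s t_gt0).
by rewrite addn0.
Qed.

(** The letter [x s] moves [v (s + j)] to [v (s + j.+1)] or to [v (s + j.-1)].
    This is the index of the image relative to the window starting at [s.+1]. *)
Let idx s j := (if x (s + j)%N == x s then j else j.-2).

(** The term [j = 1] cannot move backwards, since it would do so along edge
    [s], and [x s] is not its own inverse. *)
Lemma not_right s j : (j < t)%N -> a s j != 0 -> x (s + j)%N != x s ->
  (2 <= j)%N /\ x (s + j.-1)%N = inv_letter (x s).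
Proof.
move=> jt aj; have t_gt0 := leq_ltn_trans (leq0n _) jt.
have := aS jt aj; rewrite letter_period // => -[->|]; first by rewrite eqxx.
case: j {aj jt} => [[]//|[|j]] [_ E] _ //.
by move/eqP: E; rewrite addn0 eq_sym (negPf (inv_letter_neq _)).
Qed.

(** The expansion of [v (s.+1 + t)] is the image under [h (x s)] of the
    expansion of [v (s + t)]. *)
Lemma coef_step s m : (m < t)%N -> a s.+1 m = \sum_(j < t | idx s j == m) a s j.
Proof.
pose c m := \sum_(j < t | idx s j == m) a s j.
move=> mt; apply: (v_inj (s := s.+1) (c := c) _ mt) => {m mt}.
have idx_lt j : (j < t)%N -> (idx s j < t)%N.
  by rewrite /idx; case: ifP => // _; apply: leq_ltn_trans; rewrite -subn2 leq_subr.
rewrite -aE.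
transitivity (\sum_(j < t) a s j *: v (s.+1 + idx s j)%N).
  have [t0|t_gt0] := posnP t.
    have z i : v i = 0 by have := aE i; rewrite t0 big_ord0 addn0.
    by rewrite z big1 // => j _; rewrite z scaler0.
  rewrite addSn step aE letter_period // mulmx_suml; apply: eq_bigr => j _.
  rewrite -scalemxAl; have [->|aj] := eqVneq (a s j) 0; first by rewrite !scale0r.
  congr (_ *: _); rewrite /idx; case: ifPn => [/eqP<-|nr].
    by rewrite -step addSn.
  have [j2 E] := not_right (ltn_ord j) aj nr.
  have -> : (s + j = (s + j.-1).+1)%N by rewrite -addnS prednK // ltnW.
  rewrite step E -mulmxA -{2}[x s]inv_letterK hK mulmx1; congr v.
  by case: (nat_of_ord j) j2 => [|[|k]] //= _; rewrite addnS.
rewrite [RHS](eq_bigr (fun m : 'I_t =>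
  \sum_(j < t) (if idx s j == m then a s j *: v (s.+1 + m)%N else 0))); last first.
  by move=> m _; rewrite scaler_suml big_mkcond.
rewrite exchange_big; apply: eq_bigr => j _ /=.
rewrite (bigD1 (Ordinal (idx_lt j (ltn_ord j)))) //= eqxx big1 ?addr0 // => m.
by rewrite eq_sym -val_eqE /= => /negPf->.
Qed.

(** A term of index [j] that moves backwards has index [j.-2] in the next
    window.  It is not cancelled there: a term arriving at the same vertex from
    the other side would do so along an edge with the same label as the edge
    next to it read backwards.  By induction it then moves forwards, against
    reducedness. *)
Lemma support_right s j : (j < t)%N -> a s j != 0 -> x (s + j)%N = x s.
Proof.
elim/ltn_ind: j s => j IH s jt aj; apply/eqP/negPn/negP => nr.
have [j2 E] := not_right jt aj nr.
have j2j : (j.-2 < j)%N by case: j j2 {IH jt aj nr E} => [|[|k]] // _; rewrite /= ltnW.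
have j2t := ltn_trans j2j jt.
have Ej : (s.+1 + j.-2 = s + j.-1)%N.
  by case: j j2 {IH jt aj nr E j2j j2t} => [|[|k]] // _; rewrite /= addnS.
have jE: a s.+1 j.-2 = a s j.
  rewrite coef_step // (bigD1 (Ordinal jt)) /=; last by rewrite /idx (negPf nr).
  rewrite big1 ?addr0 // => i /andP[iE]; rewrite -val_eqE /= => ij.
  apply/eqP; apply: contraTT iE => ai; rewrite /idx; case: ifPn => [/eqP ri|nri].
    apply/eqP => Ei; have := red (s + i); rewrite ri Ei.
    by rewrite -addSn Ej E eqxx.
  have [i2 _] := not_right (ltn_ord i) ai nri.
  apply: contra ij => /eqP; case: (nat_of_ord i) i2 => [|[|k]] //= _.
  by case: j j2 {IH jt aj nr E j2j j2t Ej} => [|[|l]] //= _ ->.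
have := IH _ j2j s.+1 j2t; rewrite jE => /(_ aj); rewrite Ej E => /esym/eqP.
by rewrite (negPf (red s)).
Qed.

(** All terms move forwards, so an expansion is carried to the next window
    without a change of its coefficients. *)
Lemma coef_const s j : (j < t)%N -> a s j = a 0 j.
Proof.
elim: s j => // s IH j jt; rewrite -IH //.
apply: (v_inj (s := s.+1) _ jt) => {j jt}.
rewrite -aE addSn step aE mulmx_suml.
apply: eq_bigr => j _; rewrite -scalemxAl.
have [->|aj] := eqVneq (a s j) 0; first by rewrite !scale0r.
have t_gt0 := leq_ltn_trans (leq0n _) (ltn_ord j).
by rewrite letter_period // -(support_right (ltn_ord j) aj) -step addSn.
Qed.

End Coefs.

(** What equality of the two counts says about a closed trajectory.  That all
    indices involved are periods of [x] is what brings in the hypothesis that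
    [u] is not a power. *)
Theorem balanced_recurrence (K : fieldType) (N r L : nat)
    (v : nat -> 'rV[K]_N) (x : nat -> letter r) (h : letter r -> 'M[K]_N)
    (t := \rank (visited v L)) :
  (forall y, h y *m h (inv_letter y) = 1%:M) ->
  (forall i, v i.+1 = v i *m h (x i)) ->
  (forall i, x i.+1 != inv_letter (x i)) -> (0 < L)%N ->
  (forall i, v (i + L)%N = v i) -> (forall i, x (i + L)%N = x i) ->
  t = (\sum_(b < r) \rank (domain v x (b, false) L))%N ->
  [/\ row_free (\matrix_(j < t) v j),
      (0 < t)%N -> forall s, x (s + t)%N = x s &
      exists2 a : nat -> K,
        forall s, v (s + t)%N = \sum_(j < t) a j *: v (s + j)%N &
        forall j, (j < t)%N -> a j != 0 -> forall s, x (s + j)%N = x s].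
Proof.
move=> hK step red L_gt0 vper xper bal.
have inj s (b c : nat -> K) :
  \sum_(j < t) b j *: v (s + j)%N = \sum_(j < t) c j *: v (s + j)%N ->
  forall j, (j < t)%N -> b j = c j.
  move=> E j jt; exact: (window_inj hK step red L_gt0 vper xper bal E (Ordinal jt)).
have [a' [aE' aS']] := recurrence_coefs hK step red L_gt0 vper xper bal.
pose a s j := if @idP (j < t)%N is ReflectT jt then a' s 0 (Ordinal jt) else 0.
have aa' s (j : 'I_t) : a s j = a' s 0 j.
  rewrite /a; case: {-}_ / idP => [jt|[]]; last exact: ltn_ord.
  by congr (a' s 0 _); exact: val_inj.
have aE s : v (s + t)%N = \sum_(j < t) a s j *: v (s + j)%N.
  by rewrite aE'; apply: eq_bigr => j _; rewrite aa'.
have aS s j : (j < t)%N -> a s j != 0 -> x (s + j)%N = x (s + t)%N \/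
  (0 < j)%N /\ x (s + j.-1)%N = inv_letter (x (s + t)%N).
  by move=> jt; rewrite (aa' s (Ordinal jt)) => /aS'.
split.
- exact: window_free_shift hK step red L_gt0 vper xper bal 0.
- move=> t_gt0 s; exact: (letter_period inj aE aS s t_gt0).
exists (a 0); first move=> s.
  rewrite aE; apply: eq_bigr => j _.
  by rewrite (coef_const hK step red inj aE aS s (ltn_ord j)).
move=> j jt aj s; apply: (support_right hK step red inj aE aS jt).
by rewrite (coef_const hK step red inj aE aS s jt).
Qed.

(** * The model trajectory of a divisor of X^d - 1 *)

Section Model.
Variables (K : fieldType) (l : nat) (p : {poly K}).
Hypothesis l_gt0 : (0 < l)%N.
Hypothesis p_mon : p \is monic.
Let k := (size p).-1.
Let t := (k * l)%N.

(** The sequence is killed by [p] evaluated at the shift by [l]. *)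
Definition annihilated N (v : nat -> 'rV[K]_N) :=
  forall s, \sum_(m < size p) p`_m *: v (s + m * l)%N = 0.

Lemma annihilated_next N (v : nat -> 'rV[K]_N) s : annihilated v ->
  v (s + t)%N = - \sum_(m < k) p`_m *: v (s + m * l)%N.
Proof.
move/(_ s); have : size p = k.+1 by rewrite prednK // lt0n size_poly_eq0 monic_neq0.
move=> E; rewrite E big_ord_recr /= -/k.
have -> : p`_k = 1 by move/monicP: p_mon.
by rewrite scale1r => /eqP; rewrite addrC addr_eq0 => /eqP.
Qed.

Lemma recurrence_ind (P : nat -> Prop) :
  (forall i, (i < t)%N -> P i) ->
  (forall s, (forall m, (m < k)%N -> P (s + m * l)%N) -> P (s + t)%N) ->
  forall i, P i.
Proof.
move=> P0 PS i; elim/ltn_ind: i => i IH; have [/P0//|ti] := ltnP i t.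
rewrite -(subnK ti); apply: PS => m mk; apply: IH.
by rewrite -[ltnRHS](subnK ti) ltn_add2l ltn_pmul2r.
Qed.

(** The element [X^(s %/ l) * q] of the copy of [K[X] / (p)] with number
    [s %% l], inside the sum of [l] such copies.  The coordinate [z] belongs to
    the monomial [X^(z %/ l)] of the copy [z %% l]. *)
Definition block_vec (s : nat) (q : {poly K}) : 'rV[K]_t :=
  \row_z if (z %% l == s %% l)%N then (('X^(s %/ l) * q) %% p)`_(z %/ l) else 0.
Definition model_vec (i : nat) := block_vec i 1.

Lemma block_vec_lin s c q1 q2 :
  block_vec s (c *: q1 + q2) = c *: block_vec s q1 + block_vec s q2.
Proof.
apply/rowP => z; rewrite !mxE; case: ifP => _; last by rewrite mulr0 addr0.
by rewrite mulrDr -scalerAr modpD modpZl coefD coefZ.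
Qed.

Lemma block_vec_0 s : block_vec s 0 = 0.
Proof. by apply/rowP => z; rewrite !mxE mulr0 mod0p coef0 if_same. Qed.

Lemma block_vecXn s a : block_vec s 'X^a = model_vec (s + a * l)%N.
Proof.
apply/rowP => z; rewrite !mxE addnC modnMDl divnMDl //.
by rewrite mulr1 exprD mulrC.
Qed.

Lemma block_vec_sum s n (c : nat -> K) :
  block_vec s (\sum_(a < n) c a *: 'X^a) = \sum_(a < n) c a *: model_vec (s + a * l)%N.
Proof.
elim: n => [|n IH]; first by rewrite !big_ord0 block_vec_0.
by rewrite !big_ord_recr /= addrC block_vec_lin block_vecXn IH addrC.
Qed.

Lemma modp_eq0_coef q : (forall m, (m < k)%N -> (q %% p)`_m = 0) -> p %| q.
Proof.
move=> H; apply/eqP/polyP => m; rewrite coef0.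
have [/H//|km] := ltnP m k; apply: nth_default; apply: leq_trans km.
by rewrite -ltnS prednK ?ltn_modp ?lt0n ?size_poly_eq0 monic_neq0.
Qed.

Lemma block_vec_dvd s q : p %| q -> block_vec s q = 0.
Proof.
move=> pq; apply/rowP => z; rewrite !mxE; case: ifP => // _.
by have /eqP-> : p %| 'X^(s %/ l) * q; rewrite ?dvdp_mull ?coef0.
Qed.

Lemma block_vec_eq0_shift s q : block_vec s q = 0 -> p %| 'X^(s %/ l) * q.
Proof.
move=> E; apply: modp_eq0_coef => m mk.
have zt : (m * l + s %% l < t)%N.
  apply: (@leq_trans (m.+1 * l)); last by rewrite leq_mul2r mk orbT.
  by rewrite mulSnr ltn_add2l ltn_mod.
have /rowP/(_ (Ordinal zt)) := E; rewrite !mxE /= modnMDl modn_mod eqxx.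
by rewrite divnMDl // [(s %% l %/ l)%N]divn_small ?ltn_mod // addn0.
Qed.

Lemma block_vec_eq0 s q : coprimep p 'X -> block_vec s q = 0 -> p %| q.
Proof.
by move=> cop /block_vec_eq0_shift; rewrite Gauss_dvdpr // coprimep_expr.
Qed.

Lemma model_vec_annihilated : annihilated model_vec.
Proof.
move=> s; rewrite -(block_vec_sum s (size p) (fun m => p`_m)).
by apply: block_vec_dvd; rewrite -poly_def coefK.
Qed.

Lemma model_vec_window (i : 'I_t) : model_vec i = delta_mx 0 i.
Proof.
apply/rowP => z; rewrite !mxE eqxx /= mulr1.
have ik : (i %/ l < k)%N by rewrite ltn_divLR.
rewrite modp_small; last by rewrite size_polyXn -ltn_predRL.
rewrite coefXn -val_eqE /=.
have -> : (z == i :> nat) = (z %/ l == i %/ l)%N && (z %% l == i %% l)%N.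
  apply/eqP/andP => [->|[/eqP zi /eqP zi']] //.
  by rewrite (divn_eq z l) zi zi' -divn_eq.
by case: (z %% l == i %% l)%N; rewrite ?andbT ?andbF.
Qed.

Lemma model_vec_window_mx : \matrix_(j < t) model_vec j = 1%:M.
Proof. by apply/row_matrixP => j; rewrite rowK model_vec_window row1. Qed.

(** Both sides satisfy the recurrence and they agree on the first [t] indices. *)
Lemma annihilated_model_vec N (v : nat -> 'rV[K]_N) : annihilated v ->
  forall i, v i = model_vec i *m \matrix_(j < t) v j.
Proof.
move=> vs; apply: recurrence_ind => [i it|s IH].
  by rewrite (model_vec_window (Ordinal it)) -rowE rowK.
rewrite !annihilated_next ?mulNmx ?mulmx_suml //; last exact: model_vec_annihilated.
congr (- _); apply: eq_bigr => m _; rewrite -scalemxAl -IH //.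
Qed.

Section Root.
Variable d : nat.
Hypothesis d_gt0 : (0 < d)%N.
Hypothesis p_dvd : p %| 'X^d - 1.

Lemma coprime_X : coprimep p 'X.
Proof.
apply: coprimep_dvdr p_dvd _.
have := coprimep_XsubC ('X^d - 1) (0 : K); rewrite subr0 => ->.
by rewrite /root !hornerE expr0n (gtn_eqF d_gt0) /= sub0r oppr_eq0 oner_eq0.
Qed.

Lemma model_vec_per i : model_vec (i + d * l)%N = model_vec i.
Proof.
rewrite -block_vecXn -[X in block_vec _ X](subrK 1) -[X in X + 1]scale1r block_vec_lin.
by rewrite block_vec_dvd // scaler0 add0r.
Qed.

Lemma size_le : (k <= d)%N.
Proof.
have q0 : 'X^d - 1 != 0 :> {poly K} by rewrite -size_poly_gt0 size_XnsubC.
have := dvdp_leq q0 p_dvd; rewrite size_XnsubC // => h.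
by rewrite -ltnS (leq_trans _ h) // prednK // lt0n size_poly_eq0 monic_neq0.
Qed.

Lemma model_vec_sum (P : pred nat) (f : nat -> nat) (c : nat -> K) :
  (forall s a, P (s + a * l)%N = P s) ->
  (forall s a, f (s + a * l)%N = (f s + a * l)%N) ->
  \sum_(i < d * l | P i) c i *: model_vec (f i) =
  \sum_(s < l | P s) block_vec (f s) (\sum_(a < d) c (s + a * l)%N *: 'X^a).
Proof.
move=> Pper fper; rewrite big_mkcond /= [RHS]big_mkcond /=.
rewrite (big_ord_mul d l (fun i => if P i then c i *: model_vec (f i) else 0)).
apply: eq_bigr => s _; case: ifP => Ps; last first.
  by rewrite big1 // => a _; rewrite Pper Ps.
rewrite (block_vec_sum _ _ (fun a => c (s + a * l)%N)).
by apply: eq_bigr => a _; rewrite Pper Ps fper.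
Qed.

(** By [finj] the terms with different [s] lie in different copies of
    [K[X] / (p)], so they vanish separately; and [X] is invertible modulo
    [p]. *)
Lemma model_vec_sum_eq0 (P : pred nat) (f : nat -> nat) (c : nat -> K) :
  (forall s a, P (s + a * l)%N = P s) ->
  (forall s a, f (s + a * l)%N = (f s + a * l)%N) ->
  (forall s s', (s < l)%N -> (s' < l)%N -> P s -> P s' -> f s = f s' %[mod l] -> s = s') ->
  \sum_(i < d * l | P i) c i *: model_vec (f i) = 0 <->
  forall s, (s < l)%N -> P s -> p %| \sum_(a < d) c (s + a * l)%N *: 'X^a.
Proof.
move=> Pper fper finj; rewrite model_vec_sum //; split=> [E s sl Ps|H]; last first.
  by rewrite big1 // => s Ps; rewrite block_vec_dvd // H.
apply: (@block_vec_eq0 (f s)); first exact: coprime_X.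
apply/rowP => z; rewrite [RHS]mxE; have [zs|zs] := eqVneq (z %% l)%N (f s %% l)%N; last first.
  by rewrite mxE (negPf zs).
have /rowP/(_ z) := E; rewrite summxE (bigD1 (Ordinal sl)) //=.
rewrite [X in _ + X]big1 ?addr0 => [->|s' /andP[Ps' ne]].
  by rewrite mxE.
rewrite mxE ifF // zs; apply/negbTE; apply: contra ne => /eqP e.
by apply/eqP/val_inj; apply: (finj s' s).
Qed.

Section Letters.
Variables (r : nat) (x : nat -> letter r).
Hypothesis red : forall i, x i.+1 != inv_letter (x i).
Hypothesis xper : forall s a, x (s + a * l)%N = x s.

Lemma endpoint_per y s a : endpoint x y (s + a * l) = (endpoint x y s + a * l)%N.
Proof. by rewrite /endpoint xper addnAC. Qed.

(** If two edges with the same generator, read in opposite directions, shared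
    an endpoint, they would be consecutive with inverse labels. *)
Lemma endpoint_inj y s s' : (s < l)%N -> (s' < l)%N -> (x s).1 = y.1 -> (x s').1 = y.1 ->
  endpoint x y s = endpoint x y s' %[mod l] -> s = s'.
Proof.
have xm i : x (i %% l)%N = x i by rewrite [in RHS](divn_eq i l) addnC xper.
have half a b : (a < l)%N -> (b < l)%N -> x a = y -> x b = inv_letter y ->
    a = b.+1 %[mod l] -> False.
  move=> al bl xa xb e; have := red b; rewrite -[x b.+1]xm -e xm xa xb inv_letterK.
  by rewrite eqxx.
move=> sl sl' /letter_dir[] e /letter_dir[] e';
  rewrite /endpoint e e' ?eqxx ?inv_letter_neq /= ?addn0 ?addn1 => E.
- by rewrite !modn_small in E.
- by case: (half s s').
- by case: (half s' s).
- apply/eqP; rewrite -(modn_small sl) -(modn_small sl') -(eqn_modDr 1) !addn1.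
  exact/eqP.
Qed.

(** The condition on the right involves only the generator of [y], so the
    sources and the targets of the edges labelled by it satisfy the same
    relations. *)
Lemma model_vec_domain_ker y (c : nat -> K) :
  \sum_(i < d * l | (x i).1 == y.1) c i *: model_vec (endpoint x y i) = 0 <->
  forall s, (s < l)%N -> (x s).1 == y.1 -> p %| \sum_(a < d) c (s + a * l)%N *: 'X^a.
Proof.
apply: (model_vec_sum_eq0 (P := fun i => (x i).1 == y.1)).
- by move=> s a; rewrite xper.
- exact: endpoint_per.
- by move=> s s' sl sl' /eqP h /eqP h'; apply: endpoint_inj h h'.
Qed.

(** The recurrence expresses an endpoint of an edge through the endpoints of
    earlier edges with the same label. *)
Lemma model_vec_domain_sub y : (domain model_vec x y (d * l) <= domain model_vec x y t)%MS.
Proof.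
apply/sumsmx_subP => i /eqP E; rewrite genmxE; move: E.
elim/recurrence_ind: (nat_of_ord i) => [{}i it E|s IH]; first exact: domain_sup.
rewrite /t xper endpoint_per => E; rewrite (annihilated_next _ model_vec_annihilated).
rewrite eqmx_opp summx_sub // => m _; apply: scalemx_sub.
by rewrite -endpoint_per IH // xper.
Qed.

Lemma model_vec_domain_rank :
  (\sum_(b < r) \rank (domain model_vec x (b, false) (d * l)) <= t)%N.
Proof.
apply: (@leq_trans (\sum_(b < r) \sum_(i < t) ((x i).1 == b))).
  apply: leq_sum => b _; apply: leq_trans (mxrankS (model_vec_domain_sub _)) _.
  by apply: rank_sum_le => i; rewrite mxrank_gen rank_leq_row.
rewrite exchange_big /= -[leqRHS]card_ord -sum1_card leq_sum // => i _.
by rewrite (bigD1 (x i).1) //= eqxx big1 // => b; rewrite eq_sym => /negPf->.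
Qed.

End Letters.

Lemma model_vec_visited_rank : \rank (visited model_vec (d * l)) = t.
Proof.
apply/eqP; rewrite eqn_leq rank_leq_col /= -[leqLHS](mxrank1 K) -model_vec_window_mx mxrankS //.
apply/row_subP => j; rewrite rowK visited_sup // (leq_trans (ltn_ord j)) //.
by rewrite /t leq_mul2r size_le orbT.
Qed.

End Root.
End Model.

(** The coefficients of [p], placed at the multiples of [l], form a relation
    among the model vectors of [p], hence among those of [p'].  They fit into
    one turn of the loop unless [p = X^d - 1]. *)
Lemma model_vec_ker_dvd (K : fieldType) (l d : nat) (p p' : {poly K}) :
  (0 < l)%N -> (0 < d)%N -> p \is monic -> p' \is monic ->
  p %| 'X^d - 1 -> p' %| 'X^d - 1 ->
  (forall c : nat -> K, \sum_(i < d * l) c i *: model_vec l p i = 0 ->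
     \sum_(i < d * l) c i *: model_vec l p' i = 0) -> p' %| p.
Proof.
move=> l_gt0 d_gt0 mp mp' pd p'd H.
have q0 : 'X^d - 1 != 0 :> {poly K} by rewrite -size_poly_gt0 size_XnsubC.
have := dvdp_leq q0 pd; rewrite size_XnsubC // leq_eqVlt => /predU1P[E|sp].
  have /eqP -> : p == 'X^d - 1; last exact: p'd.
  by rewrite -eqp_monic ?monicXnsubC // -dvdp_size_eqp // E size_XnsubC.
pose c i := if (i %% l == 0)%N then p`_(i %/ l) else 0.
have C0 s : (s < l)%N -> \sum_(a < d) c (s + a * l)%N *: 'X^a = if s == 0%N then p else 0.
  move=> sl; have cE a : c (s + a * l)%N = if s == 0%N then p`_a else 0.
    rewrite /c addnC modnMDl modn_small // divnMDl // divn_small // addn0.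
    by [].
  case: ifP cE => [_|_] cE; last by rewrite big1 // => a _; rewrite cE scale0r.
  under eq_bigr do rewrite cE.
  rewrite -(poly_def d (fun a => p`_a)); apply/polyP => a; rewrite coef_poly.
  by case: ltnP => // da; rewrite nth_default // (leq_trans _ da).
have ker (q : {poly K}) (mq : q \is monic) (qd : q %| 'X^d - 1) :
    \sum_(i < d * l) c i *: model_vec l q i = 0 <->
    forall s, (s < l)%N -> true -> q %| \sum_(a < d) c (s + a * l)%N *: 'X^a.
  apply: (model_vec_sum_eq0 l_gt0 mq d_gt0 qd (P := xpredT) (f := id)) => //.
  by move=> s s' sl sl' _ _; rewrite !modn_small.
have /ker : \sum_(i < d * l) c i *: model_vec l p' i = 0.
  by apply: H; apply/ker => // s sl _; rewrite C0 //; case: ifP; rewrite ?dvdp0.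
by move/(_ mp' p'd 0 l_gt0 isT); rewrite C0.
Qed.

(** * Matrices with a given kernel, and invertible extensions *)

Section Counting.
Variable K : finFieldType.
Local Notation q := #|K|.

Definition num_row_free m N := (\sum_(A : 'M[K]_(m, N)) row_free A)%N.

Lemma card_sub_rows m N (A : 'M[K]_(m, N)) : row_free A ->
  (\sum_(u : 'rV[K]_N) (u <= A)%MS = q ^ m)%N.
Proof.
move=> fA; rewrite -big_mkcond sum1_card.
rewrite -[m in RHS]mul1n -card_mx -(card_imset _ (row_free_inj fA)) -/(mulmx^~ A).
by apply: eq_card => u; apply/submxP/imsetP => -[D]; exists D.
Qed.

Lemma row_free_col_mx m N (u : 'rV[K]_N) (A : 'M[K]_(m, N)) :
  row_free (col_mx u A) = row_free A && ~~ (u <= A)%MS.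
Proof.
rewrite -!row_leq_rank -addsmxE addsmxC.
have -> : \rank (A + u)%MS = \rank (A + <<u>>)%MS.
  by apply/eqmx_rank/eqmxP/adds_eqmx => //; apply/eqmx_sym/genmxE.
rewrite rank_add_row add1n; case: (u <= A)%MS => /=; rewrite ?andbT ?andbF.
  by rewrite addn0; apply/negbTE; rewrite -leqNgt rank_leq_row.
by rewrite addn1 ltnS.
Qed.

(** The first row has to avoid the span of the others. *)
Lemma num_row_freeS m N : num_row_free m.+1 N = (num_row_free m N * (q ^ N - q ^ m))%N.
Proof.
rewrite /num_row_free -[m.+1]/(1 + m)%N.
rewrite (reindex (fun z : 'rV[K]_N * 'M[K]_(m, N) => col_mx z.1 z.2)) /=; last first.
  exists (fun A : 'M[K]_(1 + m, N) => (usubmx A, dsubmx A)) => [[u A] _|A _] /=.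
    by rewrite col_mxKu col_mxKd.
  by rewrite vsubmxK.
rewrite -(pair_bigA _ (fun u A => nat_of_bool (row_free (col_mx u A)))) /=.
rewrite exchange_big /= big_distrl /=; apply: eq_bigr => A _.
under eq_bigr do rewrite row_free_col_mx.
case: (boolP (row_free A)) => fA /=; last by rewrite big1.
rewrite mul1n -(card_sub_rows fA); apply/eqP.
rewrite -(eqn_add2r (\sum_(u : 'rV_N) (u <= A)%MS)) subnK; last first.
  rewrite -[N in (_ <= _ ^ N)%N]mul1n -card_mx -sum1_card; apply: leq_sum => u _.
  exact: leq_b1.
rewrite -big_split /= -[N in (_ == _ ^ N)%N]mul1n -card_mx -sum1_card.
by apply/eqP/eq_bigr => u _; case: (_ <= _)%MS.
Qed.

Lemma num_row_freeE m N : num_row_free m N = (\prod_(i < m) (q ^ N - q ^ i))%N.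
Proof.
elim: m => [|m IH]; last by rewrite big_ord_recr /= -IH num_row_freeS.
rewrite big_ord0 /num_row_free (eq_bigr (fun=> 1%N)) => [|A _].
  by rewrite sum1_card card_mx mul0n expn0.
by rewrite -row_leq_rank.
Qed.

Lemma num_row_free_gt0 m N : (m <= N)%N -> (0 < num_row_free m N)%N.
Proof.
move=> mN; rewrite num_row_freeE prodn_gt0 // => i.
rewrite subn_gt0 ltn_exp2l ?(leq_trans (ltn_ord i)) //.
exact: card_finNzRing_gt1.
Qed.

(** These are the matrices [col_base B *m C] with [C] row-free. *)
Lemma same_ker_count m N n (B : 'M[K]_(m, n)) :
  (\sum_(A : 'M[K]_(m, N)) same_ker A B)%N = num_row_free (\rank B) N.
Proof.
have sB : same_ker (col_base B) B.
  have := same_ker_free (col_base B) (row_base_free B).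
  by rewrite mulmx_base same_ker_sym.
have inj : injective (fun C : 'M[K]_(\rank B, N) => col_base B *m C).
  exact/row_full_inj/col_base_full.
rewrite /num_row_free -!big_mkcond !sum1_card -(card_imset _ inj) /=.
apply: eq_card => A; apply/idP/imsetP => [sA|[C]].
  have := same_ker_trans sB (etrans (same_ker_sym _ _) sA) => h.
  have /andP[le _] := h; have AE := ker_factor le.
  exists (pinvmx (col_base B) *m A) => //.
  rewrite -[_ \in _]/(row_free _) -row_leq_rank -{1}(same_ker_rank sA) {1}AE.
  exact: mxrankM_maxr.
move=> fC ->; apply: same_ker_trans sB; exact: same_ker_free.
Qed.

(** GL acts transitively on the matrices with the left kernel of [S], so each of
    them is hit by the same number of group elements. *)
Lemma GL_count m n (S T : 'M[K]_(m, n.+1)) : 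
  ((\sum_(g : {'GL_n.+1[K]}) (S *m GLval g == T)) * num_row_free (\rank S) n.+1 =
  same_ker S T * #|{: {'GL_n.+1[K]}}|)%N.
Proof.
have [ST|nST] := boolP (same_ker S T); last first.
  rewrite big1 // => g _; case: eqP => // E; case/same_ker_unitP: nST.
  by exists (GLval g) => //; exact: (@GL_unitmx n.+1 K g).
pose st := (\sum_(g : {'GL_n.+1[K]}) (S *m GLval g == S))%N.
have stE (T' : 'M[K]_(m, n.+1)) : same_ker T' S ->
    (\sum_(g : {'GL_n.+1[K]}) (S *m GLval g == T'))%N = st.
  rewrite same_ker_sym => /same_ker_unitP[g gu E].
  pose g0 : {'GL_n.+1[K]} := Sub g gu.
  rewrite (reindex_inj (mulIg g0)); apply: eq_bigr => h _.
  rewrite GL_MxE mulmxA -E /=; congr (nat_of_bool _).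
  by rewrite (inj_eq (row_free_inj _)) // row_free_unit.
rewrite stE; last by rewrite same_ker_sym.
rewrite mul1n -(same_ker_count _ S) big_distrr /=.
rewrite -sum1_card (eq_bigr (fun T' => \sum_(g : {'GL_n.+1[K]}) (S *m GLval g == T')))%N.
  rewrite exchange_big /=; apply: eq_bigr => g _.
  by rewrite (bigD1 (S *m GLval g)) //= eqxx big1 // => T' /negPf; rewrite eq_sym => ->.
move=> T' _; case: (boolP (same_ker T' S)) => [/stE -> //|nT]; first by rewrite muln1.
rewrite muln0 big1 // => g _; case: eqP => // E; case/negP: nT.
rewrite same_ker_sym; apply/same_ker_unitP.
by exists (GLval g) => //; exact: (@GL_unitmx n.+1 K g).
Qed.

End Counting.

(** * Closed trajectories as matrices *)

Section Loops.
Variables (K : fieldType) (r L : nat) (x : nat -> letter r).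
Hypothesis L_gt0 : (0 < L)%N.
Hypothesis xper : forall i, x (i + L)%N = x i.

Definition delta_mod i : 'rV[K]_L := \row_j (j == i %% L :> nat)%N%:R.
Definition cyclic_row N (A : 'M[K]_(L, N)) i := delta_mod i *m A.
(** As a left factor, it picks for each edge with the generator of [y] the row
    at the [y]-endpoint, and clears the other rows. *)
Definition edge_ends y : 'M[K]_L :=
  \matrix_(i < L) (if (x i).1 == y.1 then delta_mod (endpoint x y i) else 0).

Lemma delta_mod_mod i : delta_mod (i %% L)%N = delta_mod i.
Proof. by apply/rowP => j; rewrite !mxE modn_mod. Qed.

Lemma cyclic_row_mod N (A : 'M[K]_(L, N)) i : cyclic_row A (i %% L)%N = cyclic_row A i.
Proof. by rewrite /cyclic_row delta_mod_mod. Qed.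

Lemma cyclic_row_periodic N (A : 'M[K]_(L, N)) i : cyclic_row A (i + L)%N = cyclic_row A i.
Proof. by rewrite -cyclic_row_mod modnDr cyclic_row_mod. Qed.

Lemma delta_mod_ord (i : 'I_L) : delta_mod i = delta_mx 0 i.
Proof. by apply/rowP => j; rewrite !mxE eqxx /= modn_small // -val_eqE. Qed.

Lemma cyclic_rowE N (A : 'M[K]_(L, N)) (i : 'I_L) : cyclic_row A i = row i A.
Proof. by rewrite /cyclic_row delta_mod_ord -rowE. Qed.

Lemma cyclic_row_matrix N (v : nat -> 'rV[K]_N) : (forall i, v (i + L)%N = v i) ->
  cyclic_row (\matrix_(i < L) v i) =1 v.
Proof.
move=> vper i; rewrite -cyclic_row_mod.
rewrite (cyclic_rowE _ (Ordinal (ltn_pmod i L_gt0))) rowK /= [in RHS](divn_eq i L) addnC.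
by elim: (i %/ L)%N => [|j IH]; rewrite ?addn0 // mulSnr addnA vper.
Qed.

Lemma row_edge_ends y N (A : 'M[K]_(L, N)) i :
  row i (edge_ends y *m A) = if (x i).1 == y.1 then cyclic_row A (endpoint x y i) else 0.
Proof. by rewrite row_mul rowK; case: ifP => // _; rewrite mul0mx. Qed.

Lemma edge_ends_sum y N (A : 'M[K]_(L, N)) (c : 'rV[K]_L) :
  c *m (edge_ends y *m A) = \sum_(i < L | (x i).1 == y.1) c 0 i *: cyclic_row A (endpoint x y i).
Proof.
rewrite mulmx_sum_row [RHS]big_mkcond; apply: eq_bigr => i _.
by rewrite row_edge_ends; case: ifP => // _; rewrite scaler0.
Qed.

Lemma rank_cyclic_rows N (A : 'M[K]_(L, N)) : \rank (visited (cyclic_row A) L) = \rank A.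
Proof.
apply/eqmx_rank/andP; split.
  by apply/sumsmx_subP => i _; rewrite genmxE cyclic_rowE row_sub.
by apply/row_subP => i; rewrite -cyclic_rowE visited_sup.
Qed.

Lemma rank_edge_ends y N (A : 'M[K]_(L, N)) :
  \rank (edge_ends y *m A) = \rank (domain (cyclic_row A) x y L).
Proof.
apply/eqmx_rank/andP; split.
  apply/row_subP => i; rewrite row_edge_ends; case: ifP => [/eqP h|_]; last exact: sub0mx.
  exact: domain_sup.
apply/sumsmx_subP => i /eqP h; rewrite genmxE.
have := row_sub i (edge_ends y *m A); by rewrite row_edge_ends h eqxx.
Qed.

Definition compatible N (h : letter r -> 'M[K]_N) (A : 'M[K]_(L, N)) :=
  [forall b : 'I_r, edge_ends (b, false) *m A *m h (b, false) == edge_ends (b, true) *m A].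

Lemma compatibleP N (h : letter r -> 'M[K]_N) (A : 'M[K]_(L, N)) :
  (forall y, h y *m h (inv_letter y) = 1%:M) ->
  reflect (forall i, cyclic_row A i.+1 = cyclic_row A i *m h (x i)) (compatible h A).
Proof.
move=> hK; have xm i : x (i %% L)%N = x i.
  rewrite [in RHS](divn_eq i L) addnC.
  by elim: (i %/ L)%N => [|j IH]; rewrite ?addn0 // mulSnr addnA xper.
have edge b i : (x i).1 = b -> (cyclic_row A (endpoint x (b, false) i) *m h (b, false) =
    cyclic_row A (endpoint x (b, true) i)) <-> cyclic_row A i.+1 = cyclic_row A i *m h (x i).
  rewrite /endpoint; case: (x i) => b' [] /= ->;
    rewrite !eqxx ?xpair_eqE ?eqxx /= ?addn0 ?addn1; last first.
    by split=> ->.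
  split=> [<-|->]; first by rewrite -mulmxA (hK (b, false)) mulmx1.
  by rewrite -mulmxA (hK (b, true)) mulmx1.
apply: (iffP forallP) => [H i|H b]; last first.
  apply/eqP/row_matrixP => i; rewrite row_mul !row_edge_ends /=.
  by case: ifP => [/eqP hb|_]; rewrite ?mul0mx //; apply/edge.
have -> : cyclic_row A i.+1 = cyclic_row A (i %% L).+1.
  by rewrite -cyclic_row_mod -[i.+1]addn1 -modnDml addn1 cyclic_row_mod.
rewrite -(cyclic_row_mod A i) -xm.
have im := ltn_pmod i L_gt0; move: (i %% L)%N im => {}i iL.
have /eqP/row_matrixP/(_ (Ordinal iL)) := H (x i).1.
by rewrite row_mul !row_edge_ends /= eqxx => /edge; exact.
Qed.

End Loops.

Section FixedPoints.
Variables (K : finFieldType) (r L n : nat) (x : nat -> letter r).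
Hypothesis L_gt0 : (0 < L)%N.
Hypothesis xper : forall i, x (i + L)%N = x i.
Variable h : letter r -> 'M[K]_n.+1.
Hypothesis hK : forall y, h y *m h (inv_letter y) = 1%:M.

Let traj (v : 'rV[K]_n.+1) i := v *m \prod_(j < i) h (x j).

Lemma trajS v i : traj v i.+1 = traj v i *m h (x i).
Proof. by rewrite /traj big_ord_recr /= mulmxA. Qed.

(** A trajectory is determined by its first vector, and it closes up exactly
    when that vector is fixed. *)
Lemma fixed_loops : (\sum_(v : 'rV[K]_n.+1) (v *m \prod_(j < L) h (x j) == v) =
  \sum_(A : 'M[K]_(L, n.+1)) compatible x h A)%N.
Proof.
rewrite -!big_mkcond !sum1_card.
pose F (v : 'rV[K]_n.+1) := \matrix_(i < L) traj v i.
have injF : injective F.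
  move=> v w /row_matrixP/(_ (Ordinal L_gt0)); rewrite !rowK /traj /=.
  by rewrite big_ord0 !mulmx1.
rewrite -(card_imset _ injF); apply: eq_card => A; apply/imsetP/idP => [[v fv ->]|].
  have /eqP fv' : v *m \prod_(j < L) h (x j) == v := fv.
  have tper i : traj v (i + L)%N = traj v i.
    elim: i => [|i IH]; last by rewrite addSn !trajS IH xper.
    by rewrite add0n -[LHS]/(v *m _) fv' /traj big_ord0 mulmx1.
  apply/compatibleP => // i; rewrite !cyclic_row_matrix //; exact: trajS.
move/(compatibleP L_gt0 xper) => /(_ hK) step.
have trajE i : traj (cyclic_row A 0) i = cyclic_row A i.
  elim: i => [|i IH]; first by rewrite /traj big_ord0 mulmx1.
  by rewrite trajS IH step.
exists (cyclic_row A 0).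
  by rewrite -[_ \in _]/(traj (cyclic_row A 0) L == _) trajE -(cyclic_row_periodic A 0).
by apply/row_matrixP => i; rewrite rowK trajE cyclic_rowE.
Qed.

End FixedPoints.

(** * The expected number of fixed vectors *)

Section Expectation.
Variables (R : realType) (K : finFieldType) (r n : nat).
Local Notation GL := {'GL_n.+1[K]}.

Definition GLletter (g : 'I_r -> GL) (y : letter r) : 'M[K]_n.+1 :=
  GLval (letter_eval g y).

Lemma GLletterK g y : GLletter g y *m GLletter g (inv_letter y) = 1%:M.
Proof.
rewrite /GLletter letter_eval_inv.
by rewrite -[LHS]/(GLval (letter_eval g y * (letter_eval g y)^-1)%g) mulgV.
Qed.

Lemma GLval_pow_eval (g : 'I_r -> GL) (u : freegroup r) (x0 : letter r) d :
  GLval (fg_eval g (u ^+ d)%g) =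
  \prod_(i < d * size (fgword u)) GLletter g (cyclic_letter x0 u i).
Proof.
have E1 : GLval (fg_eval g u) = \prod_(i < size (fgword u)) GLletter g (cyclic_letter x0 u i).
  rewrite /fg_eval (big_nth x0) big_mkord.
  rewrite (big_morph (@GLval n.+1 K) (@GL_ME n.+1 K) (GL_1E n.+1 K)).
  by apply: eq_bigr => i _; rewrite /GLletter /cyclic_letter modn_small.
elim: d => [|d IH].
  by rewrite expg0 fg_eval1 mul0n big_ord0.
rewrite expgSr fg_evalM (@GL_ME n.+1 K) IH mulSnr big_split_ord /=; congr (_ * _).
by rewrite E1; apply: eq_bigr => i _; rewrite addnC cyclic_letter_periodic.
Qed.

Section Word.
Variables (L : nat) (x : nat -> letter r).
Hypothesis L_gt0 : (0 < L)%N.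
Hypothesis xper : forall i, x (i + L)%N = x i.

Lemma sum_compatible :
  (\sum_(g : {ffun 'I_r -> GL}) \sum_(A : 'M[K]_(L, n.+1)) compatible x (GLletter g) A =
   \sum_(A : 'M[K]_(L, n.+1)) \prod_(b < r) \sum_(h : GL)
      (edge_ends K L x (b, false) *m A *m GLval h == edge_ends K L x (b, true) *m A))%N.
Proof.
rewrite exchange_big /=; apply: eq_bigr => A _.
rewrite (bigA_distr_bigA (fun (b : 'I_r) (h : GL) => nat_of_bool
  (edge_ends K L x (b, false) *m A *m GLval h == edge_ends K L x (b, true) *m A))) /=.
apply: eq_bigr => g _; rewrite /compatible.
case: forallP => [H|/forallP].
  rewrite big1 // => b _.
  by have /eqP := H b; rewrite /GLletter /letter_eval /= => ->; rewrite eqxx.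
rewrite negb_forall => /existsP[b nb]; rewrite (bigD1 b) //=.
by move: nb; rewrite /GLletter /letter_eval /= => /negPf->.
Qed.

(** The probability that uniform independent elements of GL_N(K) have a given
    trajectory in [K^N] whose relations are those of [B]: one factor for each
    generator. *)
Definition extension_prob M N (B : 'M[K]_(L, M)) : R := \prod_(b < r)
  ((same_ker (edge_ends K L x (b, false) *m B) (edge_ends K L x (b, true) *m B))%:R /
   (num_row_free K (\rank (edge_ends K L x (b, false) *m B)) N)%:R).

Lemma extension_prob_same_ker M M' N (B : 'M[K]_(L, M)) (B' : 'M[K]_(L, M')) :
  same_ker B B' -> extension_prob N B = extension_prob N B'.
Proof.
move=> BB'; apply: eq_bigr => b _.
have sk y := same_ker_mul (edge_ends K L x y) BB'.
rewrite (same_ker_rank (sk _)); congr ((nat_of_bool _)%:R / _).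
apply/idP/idP => h.
  by apply: same_ker_trans (sk _); apply: same_ker_trans h; rewrite same_ker_sym.
apply: same_ker_trans (sk _) _; apply: same_ker_trans h _; rewrite same_ker_sym; exact: sk.
Qed.

(** Matrices are grouped by left kernel: [genmx] makes the kernel a canonical
    label [T], and [cokermx T] is a representative whose size does not depend
    on [n]. *)
Lemma sum_compatible_extension_prob : (L <= n.+1)%N ->
  (\sum_(g : {ffun 'I_r -> GL}) \sum_(A : 'M[K]_(L, n.+1)) compatible x (GLletter g) A)%N%:R
    / #|{ffun 'I_r -> GL}|%:R =
  \sum_(T : 'M[K]_L | <<T>>%MS == T)
    (num_row_free K (\rank (cokermx T)) n.+1)%:R * extension_prob n.+1 (cokermx T) :> R.
Proof.
move=> Ln; rewrite sum_compatible natr_sum mulr_suml.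
transitivity (\sum_(A : 'M[K]_(L, n.+1)) extension_prob n.+1 A).
  apply: eq_bigr => A _; rewrite natr_prod card_ffun card_ord natrX.
  rewrite -[r in X in _ / X]card_ord -prodr_const -prodf_div; apply: eq_bigr => b _.
  set N := (\sum_(h : GL) _)%N.
  have I0 : (num_row_free K (\rank (edge_ends K L x (b, false) *m A)) n.+1)%:R != 0 :> R.
    by rewrite pnatr_eq0 -lt0n num_row_free_gt0 // (leq_trans (rank_leq_row _)).
  have G0 : #|{: GL}|%:R != 0 :> R.
    by rewrite pnatr_eq0 -lt0n; apply/card_gt0P; exists 1%g.
  apply/eqP; rewrite eqr_div // -!natrM; apply/eqP; congr _%:R.
  exact: GL_count.
rewrite (partition_big (fun A => <<kermx A>>%MS) (fun T => <<T>>%MS == T)) /=; last first.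
  by move=> A _; rewrite genmx_id.
apply: eq_bigr => T /eqP TT; rewrite -same_ker_count natr_sum mulr_suml.
rewrite big_mkcond; apply: eq_bigr => A _.
have -> : (<<kermx A>>%MS == T) = same_ker A (cokermx T).
  have /eqmxP kT := kermx_cokermx T.
  rewrite -{1}TT; apply/eqP/eqmxP => [/genmxP/eqmxP h|h].
    exact: eqmx_trans h (eqmx_sym kT).
  exact/genmxP/eqmxP/(eqmx_trans h kT).
by case: ifP => [h|_]; rewrite ?mul0r // mul1r; exact: extension_prob_same_ker.
Qed.

End Word.

Lemma Efix_sum_kernels (u : freegroup r) (x0 : letter r) d :
  let L := (d * size (fgword u))%N in
  (0 < L)%N -> (L <= n.+1)%N ->
  Efix R K (u ^+ d)%g n.+1 = \sum_(T : 'M[K]_L | <<T>>%MS == T)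
    (num_row_free K (\rank (cokermx T)) n.+1)%:R *
     extension_prob (cyclic_letter x0 u) n.+1 (cokermx T).
Proof.
move=> L L_gt0 Ln.
have xper i : cyclic_letter x0 u (i + L)%N = cyclic_letter x0 u i by rewrite cyclic_letter_periodic.
rewrite -sum_compatible_extension_prob // /Efix -natr_sum; congr (_%:R / _).
apply: eq_bigr => g _; rewrite -(fixed_loops L_gt0 xper (GLletterK g)).
rewrite /fixGL -sum1_card big_mkcond /=; apply: eq_bigr => v _.
by rewrite finset.inE (GLval_pow_eval g u x0 d); case: (_ == _).
Qed.

End Expectation.

(** * Critical kernels and divisors *)

Section Classification.
Variables (K : finFieldType) (r d : nat) (u : freegroup r) (x0 : letter r).
Hypothesis d_gt0 : (0 < d)%N.
Hypothesis u_gt0 : (0 < size (fgword u))%N.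
Hypothesis u_cyc : cyclically_reduced u.
Hypothesis u_np : nonpower u.
Local Notation l := (size (fgword u)).
Local Notation L := (d * l)%N.
Local Notation x := (cyclic_letter x0 u).

Let L_gt0 : (0 < L)%N. Proof. by rewrite muln_gt0 d_gt0. Qed.
Let xper i : x (i + L)%N = x i. Proof. exact: cyclic_letter_periodic. Qed.
Let red i : x i.+1 != inv_letter (x i). Proof. exact: u_cyc. Qed.

Definition realizable N (B : 'M[K]_(L, N)) :=
  [forall b, same_ker (edge_ends K L x (b, false) *m B) (edge_ends K L x (b, true) *m B)].
Definition balanced N (B : 'M[K]_(L, N)) :=
  \rank B == (\sum_(b < r) \rank (edge_ends K L x (b, false) *m B)%R)%N.

Lemma realizable_same_ker N M (B : 'M[K]_(L, N)) (C : 'M[K]_(L, M)) :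
  same_ker B C -> realizable B -> realizable C.
Proof.
move=> BC /forallP H; apply/forallP => b.
have sk y := same_ker_mul (edge_ends K L x y) BC.
apply: same_ker_trans (sk _); apply: same_ker_trans (H b).
by rewrite same_ker_sym.
Qed.

Lemma balanced_same_ker N M (B : 'M[K]_(L, N)) (C : 'M[K]_(L, M)) :
  same_ker B C -> balanced B = balanced C.
Proof.
move=> BC; rewrite /balanced (same_ker_rank BC); congr (_ == _).
by apply: eq_bigr => b _; rewrite (same_ker_rank (same_ker_mul _ BC)).
Qed.

Lemma realizable_trajectory N (B : 'M[K]_(L, N)) : realizable B ->
  exists2 h : letter r -> 'M[K]_N, forall y, h y *m h (inv_letter y) = 1%:M &
    forall i, cyclic_row B i.+1 = cyclic_row B i *m h (x i).
Proof.
move=> /forallP vB.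
have /choice[g gP] : forall b : 'I_r, exists g, g \in unitmx /\
    edge_ends K L x (b, false) *m B *m g = edge_ends K L x (b, true) *m B.
  by move=> b; have /same_ker_unitP[g gu gE] := vB b; exists g.
pose h (y : letter r) := if y.2 then invmx (g y.1) else g y.1.
have hK y : h y *m h (inv_letter y) = 1%:M.
  by rewrite /h; case: y => b [] /=; rewrite ?mulVmx ?mulmxV //; case: (gP b).
exists h => //; apply/(compatibleP L_gt0 xper B hK)/forallP => b.
by have [_ /eqP] := gP b.
Qed.

(** The rows of [B] themselves form a trajectory to which [rank_visited_le]
    applies. *)
Lemma realizable_rank_le N (B : 'M[K]_(L, N)) : realizable B ->
  (\rank B <= \sum_(b < r) \rank (edge_ends K L x (b, false) *m B)%R)%N.
Proof.
case/realizable_trajectory => h hK step; rewrite -rank_cyclic_rows.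
under eq_bigr do rewrite rank_edge_ends.
exact: rank_visited_le hK step red.
Qed.

Definition model_mx (p : {poly K}) : 'M[K]_(L, (size p).-1 * l) :=
  \matrix_(i < L) model_vec l p i.

(** The recurrence of [balanced_recurrence] is supported on multiples of [l], and
    a trajectory satisfying it is the image of the model under an injective
    map. *)
Lemma balanced_is_model N (B : 'M[K]_(L, N)) : realizable B -> balanced B ->
  exists2 p, p \is monic /\ p %| 'X^d - 1 & same_ker B (model_mx p).
Proof.
move=> vB /eqP bB; have [h hK step] := realizable_trajectory vB.
have rB : \rank (visited (cyclic_row B) L) = \rank B by exact: rank_cyclic_rows.
have [|] := balanced_recurrence hK step red L_gt0 (cyclic_row_periodic B) xper.
  rewrite rB bB; apply: eq_bigr => b _; exact: rank_edge_ends.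
rewrite rB; set t := \rank B => wfree tper [a aE aS].
have /dvdnP[k tk] : (l %| t)%N.
  have [->|t_gt0] := posnP t; first exact: dvdn0.
  exact: (nonpower_period (x0 := x0)) (tper t_gt0).
have a0 j : (j < t)%N -> (j %% l != 0)%N -> a j = 0.
  move=> jt jl; apply/eqP; apply: contraNT jl => aj.
  exact: (nonpower_period (x0 := x0)) (aS j jt aj).
(* The coefficients at the other indices vanish by a0. *)
pose p : {poly K} := 'X^k - \poly_(m < k) a (m * l)%N.
have sp : size p = k.+1.
  by rewrite size_polyDl ?size_polyXn // size_polyN ltnS size_poly.
have pm : p \is monic.
  rewrite monicE lead_coefE sp coefB coefXn eqxx coef_poly ltnn subr0.
  by [].
have ps : annihilated l p (cyclic_row B).
  move=> s; rewrite sp big_ord_recr /= coefB coefXn eqxx coef_poly ltnn subr0 scale1r.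
  rewrite -tk aE tk (big_ord_mul k l (fun j => a j *: cyclic_row B (s + j)%N)).
  rewrite (bigD1 (Ordinal u_gt0)) //= [X in _ + (_ + X)]big1 ?addr0 => [|z z0].
    rewrite -big_split big1 //= => m _.
    by rewrite coefB coefXn ltn_eqF // coef_poly ltn_ord sub0r add0n scaleNr addNr.
  apply: big1 => m _; rewrite a0 ?scale0r //.
    rewrite tk; apply: (@leq_trans (m.+1 * l)); last by rewrite leq_mul2r ltn_ord orbT.
    by rewrite mulSn ltn_add2r.
  by rewrite addnC modnMDl modn_small //; move: z0; rewrite -val_eqE.
have kt : ((size p).-1 * l)%N = t by rewrite sp.
pose M := \matrix_(j < (size p).-1 * l) cyclic_row B j.
have vE i : cyclic_row B i = model_vec l p i *m M by exact: annihilated_model_vec.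
have Mfree : row_free M by rewrite /M kt.
exists p; last first.
  have -> : B = model_mx p *m M.
    by apply/row_matrixP => i; rewrite row_mul rowK -vE cyclic_rowE.
  exact: same_ker_free.
split=> //; suff : block_vec l p 0 ('X^d - 1) = 0.
  by move/(block_vec_eq0_shift u_gt0 pm); rewrite div0n expr0 mul1r.
have : model_vec l p (0 + d * l) = model_vec l p 0.
  by apply: (row_free_inj Mfree); rewrite -!vE cyclic_row_periodic.
rewrite -block_vecXn // => E.
have -> : 'X^d - 1 = (-1) *: 1 + 'X^d :> {poly K} by rewrite scaleN1r addrC.
by rewrite block_vec_lin E scaleN1r addNr.
Qed.

Section Model.
Variable p : {poly K}.
Hypothesis pm : p \is monic.
Hypothesis pd : p %| 'X^d - 1.

Lemma cyclic_row_model : cyclic_row (model_mx p) = model_vec l p.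
Proof.
apply/funext; apply: cyclic_row_matrix => //; exact: model_vec_per.
Qed.

Let xl s a : x (s + a * l)%N = x s. Proof. exact: cyclic_letter_periodic. Qed.

Lemma model_realizable : realizable (model_mx p).
Proof.
apply/forallP => b; apply: same_ker_rowP => c.
pose c' j := if insub j is Some i then c 0 i else 0.
have cE (i : 'I_L) : c 0 i = c' i by rewrite /c' valK.
have sumE y : c *m (edge_ends K L x y *m model_mx p) =
    \sum_(i < L | (x i).1 == y.1) c' i *: model_vec l p (endpoint x y i).
  by rewrite edge_ends_sum cyclic_row_model; apply: eq_bigr => i _; rewrite cE.
rewrite !sumE (model_vec_domain_ker u_gt0 pm d_gt0 pd red xl (b, false)).
by rewrite (model_vec_domain_ker u_gt0 pm d_gt0 pd red xl (b, true)).
Qed.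

(** One inequality holds for every realizable matrix; for the other one, the
    endpoints of the first [t] edges span all the domains. *)
Lemma model_balanced : balanced (model_mx p).
Proof.
rewrite /balanced eqn_leq realizable_rank_le ?model_realizable //=.
under eq_bigr do rewrite rank_edge_ends cyclic_row_model.
rewrite -rank_cyclic_rows cyclic_row_model model_vec_visited_rank //.
exact: model_vec_domain_rank.
Qed.

End Model.

Lemma model_inj p p' : p \is monic -> p' \is monic ->
  p %| 'X^d - 1 -> p' %| 'X^d - 1 -> same_ker (model_mx p) (model_mx p') -> p = p'.
Proof.
have half q q' : q \is monic -> q' \is monic -> q %| 'X^d - 1 -> q' %| 'X^d - 1 ->
    same_ker (model_mx q) (model_mx q') -> q' %| q.
  move=> qm q'm qd q'd /same_kerP sk.
  apply: (model_vec_ker_dvd u_gt0 d_gt0 qm q'm qd q'd) => c.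
  have rowE s : \sum_(i < L) c i *: model_vec l s i = (\row_i c i) *m model_mx s.
    by rewrite mulmx_sum_row; apply: eq_bigr => i _; rewrite mxE rowK.
  by rewrite !rowE => /sk.
move=> pm p'm pd p'd sk; apply/eqP; rewrite -eqp_monic // /eqp.
by rewrite (half p' p) ?(half p p') // same_ker_sym.
Qed.

(** The condition on [genmx] selects one matrix for each row space. *)
Definition is_critical (T : 'M[K]_L) :=
  (<<T>>%MS == T) && (realizable (cokermx T) && balanced (cokermx T)).

Lemma card_critical :
  #|is_critical| = #|` fset_set (monic_divisors ('X^d - 1 : {poly K}))|.
Proof.
set D := fset_set _.
have q0 : 'X^d - 1 != 0 :> {poly K} by rewrite -size_poly_gt0 size_XnsubC.
have memD p : (p \in D) = (p \is monic) && (p %| 'X^d - 1).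
  rewrite in_fset_set; last exact: finite_monic_divisors.
  by apply/idP/andP; rewrite inE.
pose F p := <<kermx (model_mx p)>>%MS.
have skF p : same_ker (cokermx (F p)) (model_mx p).
  rewrite /same_ker; apply/eqmxP.
  apply: eqmx_trans (genmxE (kermx (model_mx p))); exact/eqmxP/kermx_cokermx.
have injF : {in D &, injective F}.
  move=> p p'; rewrite !memD => /andP[pm pd] /andP[p'm p'd] E.
  apply: model_inj => //; have h := skF p; rewrite E in h.
  by apply: same_ker_trans (skF p'); rewrite same_ker_sym.
have uF : uniq (map F D) by rewrite map_inj_in_uniq // fset_uniq.
rewrite -(size_map F D) -(card_uniqP uF); apply: eq_card => T.
apply/idP/mapP => [/andP[/eqP TT /andP[vT bT]]|[p pD ->]].
  have [p [pm pd] sk] := balanced_is_model vT bT.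
  exists p; first by rewrite memD pm.
  rewrite /F -TT; apply/genmxP/eqmxP/eqmx_sym.
  apply: eqmx_trans (eqmxP (kermx_cokermx T)); apply: eqmx_sym; exact/eqmxP.
move: pD; rewrite memD => /andP[pm pd].
have skp : same_ker (model_mx p) (cokermx (F p)) by rewrite same_ker_sym.
apply/and3P; split; first by rewrite /F genmx_id.
  exact: realizable_same_ker skp (model_realizable pm pd).
by rewrite -(balanced_same_ker skp) model_balanced.
Qed.

End Classification.

(** * Limits *)

Section Limits.
Variables (R : realType) (K : finFieldType).
Local Notation q := (#|K|%:R : R).

Lemma q_gt1 : 1 < q.
Proof. by rewrite ltr1n card_finNzRing_gt1. Qed.

Lemma q_gt0 : 0 < q. Proof. exact: lt_trans ltr01 q_gt1. Qed.

Lemma cvg_qV : q^-1 ^+ N @[N --> \oo] --> (0 : R).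
Proof.
apply: cvg_expr; rewrite ger0_norm ?invr_ge0 ?ltW ?q_gt0 // invf_lt1 ?q_gt0 //.
exact: q_gt1.
Qed.

Lemma cvg_num_row_free m : (num_row_free K m N)%:R / q ^+ (m * N) @[N --> \oo] --> (1 : R).
Proof.
have -> : (fun N => (num_row_free K m N)%:R / q ^+ (m * N)) =
    (fun N => \prod_(i < m) ((#|K| ^ N - #|K| ^ i)%N%:R / q ^+ N)).
  apply/funext => N; rewrite num_row_freeE natr_prod prodf_div prodr_const card_ord.
  by rewrite mulnC exprM.
have prod1 : \prod_(i < m) 1 = 1 :> R by rewrite big1_eq.
rewrite -[X in _ --> X]prod1; apply: (cvg_big (@mul_continuous R)) => i _.
have : 1 - #|K|%:R ^+ i * q^-1 ^+ N @[N --> \oo] --> (1 - #|K|%:R ^+ i * 0 : R).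
  by apply: cvgB; [exact: cvg_cst|apply: cvgM; [exact: cvg_cst|exact: cvg_qV]].
rewrite mulr0 subr0; apply: cvg_trans; apply: near_eq_cvg.
exists i => // N /= iN.
rewrite natrB; last by rewrite leq_exp2l // card_finNzRing_gt1.
have qN : q ^+ N != 0 by rewrite expf_neq0 // gt_eqF ?q_gt0.
by rewrite !natrX mulrBl divff // exprVn.
Qed.

(** The quotient is asymptotic to [q ^ ((n - \sum_b k b) * N)]. *)
Lemma cvg_num_row_free_ratio (r n : nat) (k : 'I_r -> nat) :
  (n <= \sum_(b < r) k b)%N ->
  (num_row_free K n N)%:R * \prod_(b < r) (num_row_free K (k b) N)%:R^-1 @[N --> \oo] -->
  ((n == \sum_(b < r) k b)%N%:R : R).
Proof.
set s := (\sum_(b < r) k b)%N => ns.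
pose a m N : R := (num_row_free K m N)%:R / q ^+ (m * N).
have qN0 j : q ^+ j != 0 by rewrite expf_neq0 // gt_eqF ?q_gt0.
have -> : (fun N => (num_row_free K n N)%:R * \prod_(b < r) (num_row_free K (k b) N)%:R^-1) =
    (fun N => a n N * \prod_(b < r) (a (k b) N)^-1 * q^-1 ^+ ((s - n) * N) :> R).
  apply/funext => N; rewrite /a.
  have -> : \prod_(b < r) (a (k b) N)^-1 =
      q ^+ (s * N) * \prod_(b < r) (num_row_free K (k b) N)%:R^-1.
    rewrite /s big_distrl /= -prodrXr -big_split /=; apply: eq_bigr => b _.
    by rewrite /a invf_div.
  have -> : (s * N = n * N + (s - n) * N)%N by rewrite -mulnDl subnKC.
  by rewrite /a exprD exprVn; field; rewrite !qN0.
have -> : (n == s)%N%:R = 1 * \prod_(b < r) 1^-1 * (n == s)%N%:R :> R.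
  by rewrite invr1 big1_eq !mul1r.
apply: cvgM.
  apply: cvgM; first exact: cvg_num_row_free.
  apply: (cvg_big (@mul_continuous R)) => b _.
  by apply: cvgV; [exact: oner_neq0|exact: cvg_num_row_free].
have [->|ne] := eqVneq n s.
  by rewrite subnn; under eq_fun do rewrite mul0n expr0; exact: cvg_cst.
have sn : (0 < s - n)%N by rewrite subn_gt0 ltn_neqAle ne.
have -> : (fun N => q^-1 ^+ ((s - n) * N)) = (fun N => (q^-1 ^+ (s - n)) ^+ N).
  by apply/funext => N; rewrite exprM.
apply: cvg_expr; rewrite ger0_norm ?exprn_ge0 ?invr_ge0 ?ltW ?q_gt0 //.
have q1 : q^-1 < 1 by rewrite invf_lt1 ?q_gt0 // q_gt1.
by rewrite exprn_ilt1 ?invr_ge0 ?(ltW q_gt0) // -lt0n.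
Qed.
End Limits.

(** * Invariance under conjugation, and the limit of the expectation *)

Section Main.
Variables (R : realType) (K : finFieldType) (r : nat).

Lemma fg_eval_conj (G : groupType) (g : 'I_r -> G) (c u : freegroup r) :
  fg_eval g (c * u * c^-1)%g = (fg_eval g c * fg_eval g u * (fg_eval g c)^-1)%g.
Proof.
rewrite !fg_evalM; congr (_ * _)%g.
by apply: (@mulgI _ (fg_eval g c)); rewrite -fg_evalM !mulgV fg_eval1.
Qed.

Lemma fixGL_conj N (a b : {'GL_N[K]}) : fixGL (a * b * a^-1)%g = fixGL b.
Proof.
rewrite /fixGL.
have au : GLval a \in unitmx by exact: (@GL_unitmx N K a).
have inj : injective (fun v : 'rV[K]_N.-1.+1 => v *m GLval a).
  by apply: row_free_inj; rewrite row_free_unit.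
have E (v : 'rV[K]_N.-1.+1) : (v *m GLval (a * b * a^-1)%g == v) =
    (v *m GLval a *m GLval b == v *m GLval a).
  have -> : GLval (a * b * a^-1)%g = GLval a *m GLval b *m invmx (GLval a) by [].
  by rewrite -(inj_eq inj) /= !mulmxA mulmxKV.
rewrite -(card_imset [set v : 'rV[K]_N.-1.+1 | v *m GLval (a * b * a^-1)%g == v]%SET inj).
apply: eq_card => v; rewrite [RHS]finset.inE; apply/imsetP/idP => [[w]|fv].
  by rewrite finset.inE E => fw ->.
exists (v *m invmx (GLval a)); last by rewrite mulmxKV.
by rewrite finset.inE E mulmxKV.
Qed.

Lemma Efix_conj (c u : freegroup r) N :
  Efix R K (c * u * c^-1)%g N = Efix R K u N.
Proof.
rewrite /Efix; congr (_ / _); apply: eq_bigr => g _; congr _%:R.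
by rewrite fg_eval_conj fixGL_conj.
Qed.

Lemma Efix_cvg (u : freegroup r) d : (0 < d)%N -> nonpower u ->
  Efix R K (u ^+ d)%g N @[N --> \oo] -->
     (#|` fset_set (monic_divisors ('X^d - 1 : {poly K})) |%:R : R).
Proof.
move=> d_gt0 npu; have [c [u' [uE [u_gt0 u_cyc]]]] := conj_cyclically_reduced (proj1 npu).
have npu' : nonpower u' by apply: (nonpower_conj (c := c)); rewrite -uE.
have -> : (fun N => Efix R K (u ^+ d)%g N) = Efix R K (u' ^+ d)%g.
  apply/funext => N; rewrite -[RHS](Efix_conj c); congr (Efix R K _ N).
  rewrite uE; elim: (d) => [|j IH]; first by rewrite !expg0 mulg1 mulgV.
  by rewrite !expgS IH !mulgA mulgKV.
have [x0 _] : exists x0, x0 \in fgword u'.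
  by case: (fgword u') u_gt0 => // y s _; exists y; rewrite mem_head.
have L_gt0 : (0 < d * size (fgword u'))%N by rewrite muln_gt0 d_gt0.
set L := (d * size (fgword u'))%N in L_gt0.
rewrite -(card_critical K x0 d_gt0 u_gt0 u_cyc npu').
pose F (T : 'M[K]_L) (N : nat) : R := (num_row_free K (\rank (cokermx T)) N)%:R *
     extension_prob R (cyclic_letter x0 u') N (cokermx T).
have : \sum_(T : 'M[K]_L | <<T>>%MS == T) F T N @[N --> \oo] -->
    (\sum_(T : 'M[K]_L | <<T>>%MS == T) (is_critical x0 T)%:R : R).
  apply: (cvg_big (@add_continuous R)) => T /eqP TT; rewrite /F.
  rewrite /is_critical TT eqxx /=.
  have [vT|nvT] := boolP (realizable x0 (cokermx T)); last first.
    have [b nb] := forallPn nvT.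
    have w0 N : extension_prob R (cyclic_letter x0 u') N (cokermx T) = 0.
      by rewrite /extension_prob (bigD1 b) //= (negPf nb) !mul0r.
    by under eq_fun do rewrite w0 mulr0; exact: cvg_cst.
  have wE N : extension_prob R (cyclic_letter x0 u') N (cokermx T) = \prod_(b < r)
      (num_row_free K
        (\rank (edge_ends K L (cyclic_letter x0 u') (b, false) *m cokermx T)) N)%:R^-1.
    by apply: eq_bigr => b _; rewrite (forallP vT) mul1r.
  under eq_fun do rewrite wE.
  apply: cvg_num_row_free_ratio.
  exact: realizable_rank_le vT.
rewrite -natr_sum -big_mkcondr.
have -> : (\sum_(T : 'M[K]_L | (<<T>>%MS == T) && is_critical x0 T) 1 =
           #|is_critical (K := K) (d := d) (u := u') x0|)%N.
  rewrite sum1_card; apply: eq_card => T.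
  by rewrite unfold_in /= /is_critical andbA andbb.
apply: cvg_trans; apply: near_eq_cvg.
(* The formula needs a dimension at least L, so that every row-free count
   in a denominator is nonzero. *)
exists L.+1 => // -[//|N] /= LN.
by rewrite (Efix_sum_kernels R K x0 L_gt0) // ltnW.
Qed.

End Main.

Unset Implicit Arguments.

Theorem theorem1p2 (R : realType) (K : finFieldType) (r : nat) (hr : (1 <= r)%N)
    (w u : freegroup r) (d : nat) (hd : (1 <= d)%N) (hw1 : w <> 1%g)
    (hu : nonpower u) (hw : w = (u ^+ d)%g) :
  (Efix R K w N @[N --> \oo] -->
     (#|` fset_set (monic_divisors ('X^d - 1 : {poly K})) |%:R : R)) /\
  (forall u' : freegroup r, nonpower u' ->
     limn (Efix R K (u' ^+ d)%g) = limn (Efix R K w)).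
Proof.
rewrite hw; split; first exact: Efix_cvg.
move=> u' npu'; rewrite (cvg_lim _ (Efix_cvg hd hu)) //.
exact: (cvg_lim _ (Efix_cvg hd npu')).
Qed.
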